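(* For any $K>0$, there exists $\kappa>0$ such that, for any $m\ge1$ and any Bohnenblust--Hille exponent $(q_1,\dots,q_m)\in[1,2]^m$ with $\left|q_i-\frac{2m}{m+1}\right|\le\frac Km$ for all $i\in\{1,\dots,m\}$, $$\mathrm B_{\mathbb C,q_1,\dots,q_m}\le\kappa\, m^{\frac{1-\gamma}2},$$ where $\gamma$ is the Euler--Mascheroni constant.
   Context: A multi-index $(q_1,\dots,q_m)$ is called a Bohnenblust--Hille exponent if $\frac1{q_1}+\cdots+\frac1{q_m}=\frac{m+1}2$. For such an exponent with all $q_i\in[1,2]$, $\mathrm B_{\mathbb C,q_1,\dots,q_m}$ denotes the best (smallest) constant $B\ge1$ such that, for all continuous $m$-linear forms $L:c_0\times\cdots\times c_0\to\mathbb C$ (with $c_0$ the complex Banach space of null sequences with the sup norm, and $(e_i)$ its canonical basis), $$\left(\sum_{i_1=1}^\infty\left(\sum_{i_2=1}^\infty\left(\cdots\left(\sum_{i_{m-1}=1}^\infty\left(\sum_{i_m=1}^\infty|L(e_{i_1},\dots,e_{i_m})|^{q_m}\right)^{\frac{q_{m-1}}{q_m}}\right)^{\frac{q_{m-2}}{q_{m-1}}}\cdots\right)^{\frac{q_2}{q_3}}\right)^{\frac{q_1}{q_2}}\right)^{\frac1{q_1}}\le B\,\|L\|,$$ where $\|L\|$ is the supremum of $|L|$ on the product of the unit balls. Such a finite constant is known to exist. *)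

(* Defs.v *)
From HB Require Import structures.
From mathcomp Require Import all_boot all_order all_algebra complex.
From mathcomp Require Import all_classical all_reals all_analysis.

Set Implicit Arguments.
Unset Strict Implicit.
Unset Printing Implicit Defensive.

Import Order.TTheory GRing.Theory Num.Theory.
Import numFieldNormedType.Exports Normc.

Local Open Scope classical_set_scope.
Local Open Scope ring_scope.
Local Open Scope complex_scope.

(* The usual norm and topology of the complex numbers; MathComp-Analysis only
   declares them on the regular module R[i]^o.  Over R[i] the norm `|z| is
   itself complex-valued; the real-valued modulus is [normc z]. *)
HB.instance Definition _ (R : realType) := NormedModule.copy R[i] R[i]^o.

Section NullSequences.
Variable R : realType.

Definition null_seq : {pred nat -> R[i]} :=
  fun u => `[< u n @[n --> \oo] --> (0 : R[i]) >].

Record c0 := C0 { c0_seq :> nat -> R[i]; c0P : c0_seq \in null_seq }.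

HB.instance Definition _ := [isSub for c0_seq].
HB.instance Definition _ := [Choice of c0 by <:].

Lemma null_seq_submod_closed : submod_closed null_seq.
Proof.
split; first by apply/asboolP; exact: cvg_cst.
move=> a u v /asboolP u0 /asboolP v0; apply/asboolP.
have -> : (0 : R[i]) = a *: (0 : R[i]) + 0 by rewrite scaler0 addr0.
exact: (cvgD (cvgZr u0) v0).
Qed.

HB.instance Definition _ :=
  GRing.isSubmodClosed.Build _ _ null_seq null_seq_submod_closed.
HB.instance Definition _ := [SubChoice_isSubLmodule of c0 by <:].

Definition sup_norm (x : c0) : R := sup (range (fun n => normc (x n))).

Lemma normc_norm (z : R[i]) : `|z| = (normc z)%:C.
Proof. by []. Qed.

Lemma c0_has_sup (x : c0) : has_sup (range (fun n => normc (x n))).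
Proof.
split; first by exists (normc (x 0)), 0.
have /asboolP x0 := c0P x.
have /cvg_seq_bounded/pinfty_ex_gt0[M M0 xM] : cvgn (c0_seq x).
  by apply/cvg_ex; exists 0.
exists (complex.Re M) => _ [n _ <-].
have := xM n I; rewrite /= normc_norm.
by case: M {M0 xM} => a b; rewrite lecE /= => /andP[].
Qed.

Lemma normc_le_sup_norm (x : c0) n : normc (x n) <= sup_norm x.
Proof. by apply: sup_upper_bound; [exact: c0_has_sup|exists n]. Qed.

Lemma sup_norm_le (x : c0) M :
  (forall n, normc (x n) <= M) -> sup_norm x <= M.
Proof.
by move=> xM; apply: ge_sup; [exists (normc (x 0)), 0|move=> _ [n _ <-]].
Qed.

Lemma sup_norm_ge0 x : 0 <= sup_norm x.
Proof.
apply: le_trans (normc_le_sup_norm x 0).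
by rewrite -lecR -normc_norm normr_ge0.
Qed.

Lemma sup_normD x y :
  (sup_norm (x + y))%:C <= (sup_norm x)%:C + (sup_norm y)%:C.
Proof.
rewrite -rmorphD lecR; apply: sup_norm_le => n.
apply: (le_trans (le_normcD (x n) (y n))).
by apply: lerD; exact: normc_le_sup_norm.
Qed.

Lemma sup_normZ (l : R[i]) x : (sup_norm (l *: x))%:C = `|l| * (sup_norm x)%:C.
Proof.
have le_sup_normZ k y : sup_norm (k *: y) <= normc k * sup_norm y.
  apply: sup_norm_le => n; rewrite [X in normc X](_ : _ = k * y n)// normcM.
  apply: ler_wpM2l (normc_le_sup_norm y n).
  by rewrite -lecR -normc_norm normr_ge0.
rewrite normc_norm -rmorphM; congr (_%:C); apply/eqP; rewrite eq_le.
rewrite le_sup_normZ /=; have [->|l0] := eqVneq l 0.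
  by rewrite normc0 mul0r sup_norm_ge0.
have nl0 : 0 < normc l by rewrite -ltcR -normc_norm normr_gt0.
rewrite -ler_pdivlMl// -normcV -{1}[x](scalerK l0).
exact: le_sup_normZ.
Qed.

Lemma sup_norm_eq0 x : (sup_norm x)%:C = 0 -> x = 0.
Proof.
move=> [x0]; apply/val_inj/funext => n.
apply: eq0_normc; apply/eqP; rewrite eq_le -{1}x0 normc_le_sup_norm.
by rewrite -lecR -normc_norm normr_ge0.
Qed.

HB.instance Definition _ :=
  Lmodule_isNormed.Build R[i] c0 sup_normD sup_normZ sup_norm_eq0.

Lemma c0_basis_subproof (i : nat) :
  (fun j => (j == i)%:R : R[i]) \in null_seq.
Proof.
apply/asboolP; apply: cvg_near_cst; near=> j.
by rewrite gtn_eqF//; near: j; exact: nbhs_infty_gt.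
Unshelve. all: by end_near. Qed.

Definition c0_basis (i : nat) : c0 := C0 (c0_basis_subproof i).

End NullSequences.

Section BohnenblustHille.
Variable R : realType.

Definition multilinear (m : nat) (L : ('I_m -> c0 R) -> R[i]) : Prop :=
  forall (i : 'I_m) (x : 'I_m -> c0 R),
    linear (fun y : c0 R => L [eta x with i |-> y]).

(* Supremum of |L| on the product of the unit balls. *)
Definition form_norm (m : nat) (L : ('I_m -> c0 R) -> R[i]) : \bar R :=
  ereal_sup [set (normc (L x))%:E | x in [set x | forall k, `|x k| <= 1]].

Local Open Scope ereal_scope.

(* For q = [:: q_1; ..; q_m] this is
     \sum_(i_1) (\sum_(i_2) ( .. (\sum_(i_m) (a [:: i_1; ..; i_m]) ^ q_m)
       ^ (q_(m-1) / q_m) .. ) ^ (q_2 / q_3)) ^ (q_1 / q_2),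
   the innermost exponent q_m being read as q_m / 1 ([head] on the empty
   list).  The terms are nonnegative, so the series always have a value in
   [0, +oo]. *)
Fixpoint nested_sum (q : seq R) (a : seq nat -> \bar R) : \bar R :=
  if q is p :: q' then
    \sum_(0 <= i <oo)
      (nested_sum q' (fun s => a (i :: s))) `^ (p / head 1 q')%R
  else a [::].

Definition mixed_norm (q : seq R) (a : seq nat -> \bar R) : \bar R :=
  (nested_sum q a) `^ (head 1%R q)^-1.

Definition coeff_modulus (m : nat) (L : ('I_m -> c0 R) -> R[i])
    (s : seq nat) : \bar R :=
  (normc (L (fun k : 'I_m => c0_basis R (nth 0%N s k))))%:E.

Definition BH_exponent (m : nat) (q : m.-tuple R) : Prop :=
  (\sum_(i < m) (tnth q i)^-1 = m.+1%:R / 2)%R.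

(* Continuity is for the product topology on c0^m.  The set of admissible B is
   closed, so its infimum is the best constant when it is nonempty, and +oo
   otherwise. *)
Definition BH_constant (m : nat) (q : m.-tuple R) : \bar R :=
  ereal_inf [set B%:E | B in [set B : R | (1 <= B)%R /\
    forall L : {ptws 'I_m -> c0 R} -> R[i],
      multilinear L -> continuous L ->
      mixed_norm q (coeff_modulus L) <= B%:E * form_norm L]].

End BohnenblustHille.

Definition euler_gamma (R : realType) : R :=
  limn (fun n => \sum_(1 <= k < n.+1) k%:R^-1 - ln n%:R).

(* Main.v *)
Require Import Defs.
From HB Require Import structures.
From mathcomp Require Import all_boot all_order all_algebra complex.
From mathcomp Require Import all_classical all_reals all_analysis.
From mathcomp Require Import ring lra.
Import Order.TTheory GRing.Theory Num.Theory.
Import numFieldNormedType.Exports Normc.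

Set Implicit Arguments.
Unset Strict Implicit.
Unset Printing Implicit Defensive.
Local Open Scope classical_set_scope.
Local Open Scope ring_scope.

(** The exponent near [2 m / (m + 1)] is reached by interpolation, and the power
[(1 - gamma) / 2] comes from a sharp first-order form of the
Khinchine-Steinhaus inequality.

Write [x_i = 2 / q_i - 1]. The hypotheses say that [x] is a probability vector
with [x_i <= 1 / k] for some [k] comparable to [m]. The mixed norm of an array
is log-convex in the reciprocal exponents ([mnorm_interpolation]), and the
extreme points of the polytope [0 <= x_i <= 1 / k, \sum_i x_i = 1] are the
vectors equal to [1 / k] on a set of [k] indices and [0] elsewhere
([mnorm_vertices]). So it is enough to treat exponents equal to
[l = 2 k / (k + 1)] on [k] coordinates and to [2] on the others. On each of the
latter, the square sum is replaced by an average over random unimodular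
multipliers, at the price of one Khinchine constant [C_l], and the multipliers
are then pulled out of all the sums with the Minkowski inequality
([mnorm_le_pattern_sum]). What is left is a [k]-linear form of no larger norm,
with [k] equal exponents ([pattern_sum_le]). Hence a bound [B_k] for
[k]-linear forms and equal exponents gives the bound [C_l ^ (m - k) * B_k] for
[m]-linear ones ([mnorm_le_bh_bound]). With [m = k + 1] this is an induction
for the constants [B_k]; with [k] comparable to [m] it is the theorem.

The constant [C_l] must be right to first order as [l] tends to [2]. Let
[S = \sum_j b_j z_j] with [\sum_j |b_j| ^ 2 = 1] and [z_j] independent and
uniform on the circle. By convexity of the exponential,
[E |S| ^ l >= exp (- (1 - l / 2) * E (|S| ^ 2 * ln (|S| ^ 2)))], so everything
rests on [E (|S| ^ 2 * ln (|S| ^ 2)) <= 1 - gamma] ([sign_entropy]); the right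
hand side is the value for a complex Gaussian [g] with [E |g| ^ 2 = 1]. Then
[C_l = exp ((1 / l - 1 / 2) * (1 - gamma))], which is
[exp ((1 - gamma) / (2 k))] for [l = 2 k / (k + 1)], and the product of these
constants over [k < m] is at most a constant times [m ^ ((1 - gamma) / 2)].

The entropy inequality is proved along the heat flow. Let [G s t] be the mean
of [|w + sqrt s * g| ^ 2 * ln (|w + sqrt s * g| ^ 2)] where [|w| ^ 2 = t]. It
is an explicit function ([heatG]) of the exponential integral. Adding to [w] a
vector of fixed length [a] and uniform direction changes the mean of [G s] by
no more than replacing [s] by [s + a ^ 2] ([heat_step]): along
[s + a ^ 2 - r ^ 2], [0 <= r <= a], the circle mean of radius [r] has a
derivative of constant sign, because [G] solves the heat equation and its
Laplacian is subharmonic. Adding the vectors [b_j z_j] one after the other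
leads from [G 0] at [S] to [G 1 0 = 1 - gamma].

The random multipliers are [N]-th roots of unity, so that every expectation is
a finite sum. Angular derivatives then have means of order [1 / N] instead of
[0], and the flow is started at a small time [delta], where [G] is smooth;
[N] goes to infinity before [delta] goes to [0]. This proves the inequalities
with any [kappa > 1 - gamma] in place of [1 - gamma], which is enough since
[kappa] may depend on [m]. *)

(** * Moments of the exponential and the entire exponential integral *)

Section ExpMoments.
Variable R : realType.
Implicit Types (c : R^nat) (x y : R).

(** Domination by the exponential series: it makes the sum entire and is
inherited by the formal derivatives used below. *)
Definition fact_dominated c := forall k, `|c k| <= k`!%:R^-1.

Lemma is_cvg_fact_dominated c x : fact_dominated c -> cvgn (pseries c x).
Proof.
move=> cle; rewrite /pseries; apply: normed_cvg.
apply: series_le_cvg (is_cvg_series_exp_coeff `|x|) => n /=.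
- exact: normr_ge0.
- by rewrite exp_coeffE mulr_ge0// exprn_ge0.
- by rewrite exp_coeffE /= normrM normrX ler_wpM2r ?exprn_ge0.
Qed.

Lemma lim_pseries_le c x : fact_dominated c ->
  `|limn (pseries c x)| <= expR `|x|.
Proof.
move=> cle.
have cn : cvgn [normed pseries c x].
  rewrite /normed_series_of /=.
  rewrite (_ : (fun _ => _) = fun i => `|c i| * `|x| ^+ i); last first.
    by apply/funext => i; rewrite normrM normrX.
  apply: (@is_cvg_fact_dominated (fun i => `|c i|)) => k.
  by rewrite normr_id.
rewrite (le_trans (lim_series_norm cn))//.
rewrite expRE; apply: ler_lim => //.
  apply: (@is_cvg_fact_dominated (fun n => (n`!%:R)^-1)) => k.
  by rewrite ger0_norm.
near=> n; apply: ler_sum => i _.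
by rewrite /= normrM normrX ler_wpM2r ?exprn_ge0.
Unshelve. all: by end_near. Qed.

Lemma is_derive_pseries c x : fact_dominated c ->
  fact_dominated (pseries_diffs c) ->
  fact_dominated (pseries_diffs (pseries_diffs c)) ->
  is_derive x 1 (fun x => limn (pseries c x))
    (limn (pseries (pseries_diffs c) x)).
Proof.
move=> c0 c1 c2; apply: (@pseries_snd_diffs _ _ (`|x| + 1));
  try exact: is_cvg_fact_dominated.
by rewrite [ltRHS]ger0_norm// ltrDl.
Qed.

Definition expmom_coeff j : R^nat := fun k => (k`!%:R * (k + j).+1%:R)^-1.

(** This is [\int_0^1 v ^ j * exp (v y) dv]. *)
Definition expmom j y : R := limn (pseries (expmom_coeff j) y).

Lemma fact_dominated_expmom j : fact_dominated (expmom_coeff j).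
Proof.
move=> k; rewrite /expmom_coeff ger0_norm ?invr_ge0// invfM ler_piMr ?invr_ge0//.
by rewrite invf_le1 ?ler1n.
Qed.

Lemma expmom_coeff_diffs j : pseries_diffs (expmom_coeff j) = expmom_coeff j.+1.
Proof.
apply/funext => k; rewrite /pseries_diffs /expmom_coeff factS natrM addSnnS.
by field; rewrite !nat1r -natrD nat1r !pnatr_eq0 -!lt0n fact_gt0.
Qed.

Lemma is_derive_expmom j y : is_derive y 1 (expmom j) (expmom j.+1 y).
Proof.
have fd i := @fact_dominated_expmom i.
rewrite /expmom -expmom_coeff_diffs; apply: is_derive_pseries => //.
  by rewrite expmom_coeff_diffs.
by rewrite !expmom_coeff_diffs.
Qed.

Lemma expmom_le j y : `|expmom j y| <= expR `|y|.
Proof. exact/lim_pseries_le/fact_dominated_expmom. Qed.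

(** This is the integral of the derivative of [v * exp (v y)] over [0, 1]. *)
Lemma expmom_rec y : expmom 0 y + y * expmom 1 y = expR y.
Proof.
have c0 := @is_cvg_fact_dominated _ y (@fact_dominated_expmom 0).
have c1 := @is_cvg_fact_dominated _ y (@fact_dominated_expmom 1).
rewrite expRE; apply/esym/cvg_lim => //.
have -> : pseries (fun n => n`!%:R^-1) y = (fun n =>
    pseries (expmom_coeff 0) y n + y * pseries (expmom_coeff 1) y n.-1).
  apply/funext => -[|n]; first by rewrite /pseries /series /= !big_geq// mulr0 addr0.
  rewrite /pseries /series /= mulr_sumr big_nat_recl// [in RHS]big_nat_recl//.
  rewrite -addrA -big_split /=; congr (_ + _).
    by rewrite /expmom_coeff fact0 mul1r addn0.
  apply: eq_bigr => i _; rewrite /expmom_coeff factS natrM addn0 addn1 exprS.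
  by field; rewrite -natrD !nat1r !pnatr_eq0 -!lt0n fact_gt0.
apply: cvgD => //; apply: cvgM; first exact: cvg_cst.
by rewrite -[X in X @ _ --> _]/(fun n => pseries (expmom_coeff 1) y n.-1) -cvg_shiftS.
Qed.

Lemma expmom0E y : y * expmom 0 y = expR y - 1.
Proof.
pose f y : R := y * expmom 0 y - expR y.
have df (z : R) : is_derive z 1 f 0.
  have d0 := is_derive_expmom 0 z.
  rewrite /f; apply: is_derive_eq.
  rewrite /GRing.scale /= mulr1.
  by rewrite -expmom_rec; ring.
have : f y = -1 by rewrite (@is_derive_0_is_cst _ f y 0)// /f mul0r expR0 sub0r.
by rewrite /f => /eqP; rewrite subr_eq addrC => /eqP ->.
Qed.

Definition expint_coeff : R^nat := fun k => (k`!%:R * k%:R)^-1.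

(** This is [\int_0^y (exp v - 1) / v dv]. *)
Definition expint y : R := limn (pseries expint_coeff y).

Lemma fact_dominated_expint : fact_dominated expint_coeff.
Proof.
move=> [|k]; first by rewrite /expint_coeff mulr0 invr0 normr0.
rewrite /expint_coeff ger0_norm ?invr_ge0// invfM ler_piMr ?invr_ge0//.
by rewrite invf_le1 ?ler1n.
Qed.

Lemma is_derive_expint y : is_derive y 1 expint (expmom 0 y).
Proof.
have dE : pseries_diffs expint_coeff = expmom_coeff 0.
  apply/funext => k; rewrite /pseries_diffs /expint_coeff /expmom_coeff.
  rewrite factS natrM addn0; field.
  by rewrite ?nat1r !pnatr_eq0 -?lt0n ?fact_gt0.
rewrite /expmom -dE; apply: is_derive_pseries; rewrite ?dE.
- exact: fact_dominated_expint.
- exact: fact_dominated_expmom.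
- by rewrite expmom_coeff_diffs; exact: fact_dominated_expmom.
Qed.

Lemma expint0 : expint 0 = 0.
Proof.
rewrite /expint /pseries; apply: lim_near_cst => //; near=> n.
rewrite /series /= big1// => -[|k] _; last by rewrite expr0n mulr0.
by rewrite /expint_coeff mulr0 invr0 mul0r.
Unshelve. all: by end_near. Qed.

End ExpMoments.

(** * Derivatives of explicit functions and mean value inequalities *)

Section PointwiseDerivatives.
Variable R : realType.
Implicit Types (f g : R -> R) (x a b c : R).

Lemma der_eq f x a b : is_derive x 1 f a -> a = b -> is_derive x 1 f b.
Proof. by move=> + <-. Qed.

Lemma der_cst c x : is_derive x 1 (fun=> c) 0.
Proof. exact: is_derive_cst. Qed.

Lemma der_id x : is_derive x 1 (fun z : R => z) 1.
Proof. exact: is_derive_id. Qed.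

Lemma der_opp f x a : is_derive x 1 f a -> is_derive x 1 (fun z => - f z) (- a).
Proof. by move=> fa; exact: is_deriveN. Qed.

Lemma der_add f g x a b : is_derive x 1 f a -> is_derive x 1 g b ->
  is_derive x 1 (fun z => f z + g z) (a + b).
Proof. by move=> fa gb; exact: is_deriveD. Qed.

Lemma der_mul f g x a b : is_derive x 1 f a -> is_derive x 1 g b ->
  is_derive x 1 (fun z => f z * g z) (a * g x + f x * b).
Proof.
move=> fa gb; rewrite addrC [a * _]mulrC.
by have := is_deriveM fa gb.
Qed.

Lemma der_exp f x a n : is_derive x 1 f a ->
  is_derive x 1 (fun z => f z ^+ n) (n%:R * f x ^+ n.-1 * a).
Proof. by move=> fa; rewrite -[X in is_derive _ _ X]exprfctE; exact: is_deriveX. Qed.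

Lemma der_inv f x a : f x != 0 -> is_derive x 1 f a ->
  is_derive x 1 (fun z => (f z)^-1) (- a / f x ^+ 2).
Proof.
move=> fx0 fa; apply: der_eq (is_deriveV fx0 fa) _.
by rewrite /GRing.scale/= mulNr mulrC mulNr.
Qed.

Lemma der_comp f g x a b : is_derive (g x) 1 f a -> is_derive x 1 g b ->
  is_derive x 1 (fun z => f (g z)) (a * b).
Proof. by move=> fa gb; exact: (is_derive1_comp fa gb). Qed.

Lemma der_sum n (f : 'I_n -> R -> R) x (a : 'I_n -> R) :
  (forall i, is_derive x 1 (f i) (a i)) ->
  is_derive x 1 (fun z => \sum_(i < n) f i z) (\sum_(i < n) a i).
Proof.
move=> fa; rewrite (_ : (fun _ => _) = \sum_(i < n) f i).
  exact: is_derive_sum.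
by apply/funext => z; rewrite fct_sumE.
Qed.

End PointwiseDerivatives.

(* the matched subterms are eta-expanded to fix the type of their argument *)
Ltac fun_over R f := eval cbv beta in (fun z : Real.sort R => f z).

(* [der R] differentiates an explicit function by its syntax, using hypotheses
   for the functions that it does not know; [derive_by R] leaves the comparison
   of the result with the announced derivative *)
Ltac der R :=
  let comp h g H :=
    (let g' := fun_over R g in notypeclasses refine (@der_comp R h g' _ _ _ _ _); [apply: H|der R]) in
  lazymatch goal with
  | |- is_derive _ _ (fun _ => ?c) _ => apply: der_cst
  | |- is_derive _ _ (fun z => z) _ => apply: der_id
  | |- is_derive _ _ (fun z => - (@?f z)) _ =>
      let f' := fun_over R f in notypeclasses refine (@der_opp R f' _ _ _); der R
  | |- is_derive _ _ (fun z => (@?f z) + (@?g z)) _ =>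
      let f' := fun_over R f in let g' := fun_over R g in
      notypeclasses refine (@der_add R f' g' _ _ _ _ _); der R
  | |- is_derive _ _ (fun z => (@?f z) * (@?g z)) _ =>
      let f' := fun_over R f in let g' := fun_over R g in
      notypeclasses refine (@der_mul R f' g' _ _ _ _ _); der R
  | |- is_derive _ _ (fun z => (@?f z) ^+ ?n) _ =>
      let f' := fun_over R f in notypeclasses refine (@der_exp R f' _ _ _ _); der R
  | |- is_derive _ _ (fun z => (@?f z)^-1) _ =>
      let f' := fun_over R f in notypeclasses refine (@der_inv R f' _ _ _ _); [idtac|der R]
  | |- is_derive _ _ (fun z => expR (@?g z)) _ => comp (@expR R) g (@is_derive_expR R)
  | |- is_derive _ _ (fun z => cos (@?g z)) _ => comp (@cos R) g (@is_derive_cos R)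
  | |- is_derive _ _ (fun z => sin (@?g z)) _ => comp (@sin R) g (@is_derive_sin R)
  | |- is_derive _ _ (fun z => ln (@?g z)) _ => comp (@ln R) g (@is_derive1_ln R)
  | |- is_derive _ _ (fun z => expmom ?j (@?g z)) _ =>
      comp (@expmom R j) g (@is_derive_expmom R j)
  | |- is_derive _ _ (fun z => expint (@?g z)) _ =>
      comp (@expint R) g (@is_derive_expint R)
  | |- is_derive _ _ (fun z => ?h (@?g z)) _ =>
      first [eassumption
        | match goal with H : forall t, is_derive t _ h _ |- _ => comp h g H end]
  | |- _ => try eassumption
  end.

Ltac derive_by R := lazymatch goal with |- is_derive ?x _ ?f ?b =>
  notypeclasses refine (@der_eq R f x _ b _ _); [by der R|] end.

Section MeanValue.
Variable R : realType.

Lemma is_derive1_continuous (f : R -> R) (x d : R) :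
  is_derive x 1 f d -> {for x, continuous f}.
Proof. by case=> df _; exact/differentiable_continuous/derivable1_diffP. Qed.

Lemma MVT_ge (f df : R -> R) (a b c : R) : a <= b ->
  (forall x, a <= x <= b -> is_derive x 1 f (df x)) ->
  (forall x, a < x < b -> c <= df x) -> c * (b - a) <= f b - f a.
Proof.
rewrite le_eqVlt => /predU1P[<- _ _|ab fdf cdf]; first by rewrite !subrr mulr0.
have [||x] := @MVT R f df a b ab.
- by move=> x; rewrite in_itv/= => /andP[ax xb]; apply: fdf; rewrite !ltW.
- apply: continuous_in_subspaceT => x; rewrite inE/= in_itv/= => xab.
  exact: is_derive1_continuous (fdf _ xab).
rewrite in_itv/= => xab ->.
by apply: ler_wpM2r; [rewrite subr_ge0 ltW|exact: cdf].
Qed.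

Lemma MVT_le (f df : R -> R) (a b c : R) : a <= b ->
  (forall x, a <= x <= b -> is_derive x 1 f (df x)) ->
  (forall x, a < x < b -> df x <= c) -> f b - f a <= c * (b - a).
Proof.
move=> ab fdf dfc.
suff: - c * (b - a) <= - f b - - f a by lra.
apply: (@MVT_ge (fun x => - f x) (fun x => - df x)) => // x xab.
  by have := fdf x xab; exact: is_deriveN.
by rewrite lerN2 dfc.
Qed.

End MeanValue.

(** * The Euler-Mascheroni constant and the exponential integral *)

Section EulerGamma.
Variable R : realType.
Implicit Types x : R.

(** The entire exponential integral [\int_0^x (1 - exp (- v)) / v dv]. *)
Definition ein x : R := - expint (- x).

Lemma is_derive_ein x : is_derive x 1 ein (expmom 0 (- x)).
Proof.
rewrite /ein; derive_by R.
by rewrite mulrN1 opprK.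
Qed.

Lemma ein0 : ein 0 = 0.
Proof. by rewrite /ein oppr0 expint0 oppr0. Qed.

Let u n : R := \sum_(1 <= k < n.+1) k%:R^-1 - ln n%:R.

Let ln_succ n : ln n.+2%:R <= ln n.+1%:R + n.+1%:R^-1 :> R.
Proof.
have -> : n.+2%:R = n.+1%:R * (1 + n.+1%:R^-1) :> R.
  by rewrite mulrDr mulr1 divff ?pnatr_eq0// natr1.
rewrite lnM ?posrE ?ltr0n ?addr_gt0 ?invr_gt0 ?ltr0n// lerD2l le_ln1Dx//.
by rewrite (lt_trans _ (_ : 0 < _))// invr_gt0 ltr0n.
Qed.

Let ln_pred n : ln n.+1%:R <= ln n.+2%:R - n.+2%:R^-1 :> R.
Proof.
have -> : n.+1%:R = n.+2%:R * (1 - n.+2%:R^-1) :> R.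
  by rewrite mulrBr mulr1 divff ?pnatr_eq0// -[in RHS]natr1 addrK.
have n2 : (n.+2%:R^-1 : R) < 1 by rewrite invf_lt1 ?ltr0n ?ltr1n.
rewrite lnM ?posrE ?ltr0n ?subr_gt0// lerD2l le_ln1Dx//.
by rewrite ltrN2.
Qed.

Lemma ln_le_harmonic n : ln n.+1%:R <= \sum_(1 <= k < n.+1) k%:R^-1 :> R.
Proof.
elim: n => [|n IH]; first by rewrite ln1 big_nil.
by rewrite big_nat_recr//= (le_trans (ln_succ n))// lerD2r.
Qed.

Lemma harmonic_le_ln n : \sum_(1 <= k < n.+2) k%:R^-1 <= 1 + ln n.+1%:R :> R.
Proof.
elim: n => [|n IH]; first by rewrite big_nat1 invr1 ln1 addr0.
rewrite big_nat_recr//= (le_trans (lerD IH (lexx _)))//.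
by rewrite -addrA lerD2l -lerBrDr ln_pred.
Qed.

Let uS_nonincr : nonincreasing_seq (fun n => u n.+1).
Proof.
apply/nonincreasing_seqP => n; rewrite /u [in leLHS]big_nat_recr//=.
by rewrite -addrA lerD2l lerNr opprB ln_pred.
Qed.

Lemma euler_gamma_le n :
  euler_gamma R <= \sum_(1 <= k < n.+2) k%:R^-1 - ln n.+1%:R.
Proof.
have cu : cvgn (fun n => u n.+1).
  apply: nonincreasing_is_cvgn => //; exists 0 => _ [k _ <-].
  rewrite /u subr_ge0 (le_trans _ (ln_le_harmonic _))//.
  by rewrite ler_ln ?posrE ?ltr0n// ler_nat.
have -> : euler_gamma R = limn (fun n => u n.+1).
  apply/cvg_lim => //; rewrite -(cvg_shiftS u).
  by case/cvg_ex : (cu) => l ul; rewrite (cvg_lim _ ul).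
exact: (nonincreasing_cvgn_ge uS_nonincr cu n).
Qed.

Lemma euler_gamma_le1 : euler_gamma R <= 1.
Proof. by have := euler_gamma_le 0; rewrite big_nat1 invr1 ln1 subr0. Qed.

Lemma expmom0NE x : x * expmom 0 (- x) = 1 - expR (- x).
Proof. by have H := expmom0E (- x); lra. Qed.

Lemma bernoulli_ineq x n : 0 <= x <= 1 -> 1 - x *+ n <= (1 - x) ^+ n.
Proof.
move=> /andP[x0 x1]; elim: n => [|n IH]; first by rewrite subr0.
have [nx|] := leP 0 (1 - x *+ n); last first.
  move=> nx; apply: (@le_trans _ _ 0); last by rewrite exprn_ge0// subr_ge0.
  by rewrite mulrS; lra.
rewrite exprS; apply: le_trans (ler_wpM2l _ IH); last by rewrite subr_ge0.
rewrite mulrS -subr_ge0.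
have -> : (1 - x) * (1 - x *+ n) - (1 - (x + x *+ n)) = x ^+ 2 *+ n.
  by ring.
by rewrite mulrn_wge0// sqr_ge0.
Qed.

(** The harmonic number is [\int_0^N (1 - (1 - x / N) ^ N) / x dx], and
[exp (- x) - (1 - x / N) ^ N <= x ^ 2 * exp (- x) / N]. The term
[(1 - (1 + x) * exp (- x)) / N] in [g] is a primitive of [x * exp (- x) / N]. *)
Lemma harmonic_le_ein n :
  \sum_(1 <= k < n.+2) k%:R^-1 <= ein n.+1%:R + n.+1%:R^-1 :> R.
Proof.
pose N : R := n.+1%:R; have N0 : 0 < N by rewrite ltr0n.
pose f x := \sum_(k < n.+1) (1 - (1 - x / N) ^+ k.+1) / k.+1%:R.
pose df x := \sum_(k < n.+1) N^-1 * (1 - x / N) ^+ k.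
pose g x := ein x + (1 - (1 + x) * expR (- x)) / N - f x.
pose dg x := expmom 0 (- x) + x * expR (- x) / N - df x.
have dfP x : is_derive x 1 f (df x).
  apply: der_sum => k; derive_by R.
  by rewrite /=; field; rewrite ?nat1r gt_eqF//= pnatr_eq0.
have dgP x : is_derive x 1 g (dg x).
  have de := is_derive_ein x; have dfx := dfP x.
  rewrite /g /dg; derive_by R.
  by rewrite /=; field; rewrite gt_eqF.
have : 0 * (N - 0) <= g N - g 0.
  apply: (MVT_ge (ltW N0) (fun x _ => dgP x)) => x /andP[x0 xN].
  rewrite -(pmulr_rge0 _ x0) /dg mulrBr mulrDr expmom0NE.
  have -> : x * df x = 1 - (1 - x / N) ^+ n.+1.
    rewrite /df -mulr_sumr mulrA; set q := 1 - x / N.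
    have -> : x * N^-1 = - (q - 1) by rewrite /q; ring.
    by rewrite mulNr -subrX1 opprB.
  suff : expR (- x) * (1 - x ^+ 2 / N) <= (1 - x / N) ^+ n.+1.
    by rewrite -subr_ge0 => /le_trans; apply; rewrite le_eqVlt; apply/orP; left; apply/eqP; ring.
  have y0 : 0 <= x / N by rewrite divr_ge0 ?ltW.
  have y1 : x / N <= 1 by rewrite ler_pdivrMr// mul1r ltW.
  have -> : expR (- x) = expR (- (x / N)) ^+ n.+1.
    by rewrite -expRM_natl -/N mulrN mulrC divfK ?gt_eqF.
  apply: (@le_trans _ _ ((expR (- (x / N)) * (1 - (x / N) ^+ 2)) ^+ n.+1)).
    rewrite exprMn ler_wpM2l ?exprn_ge0 ?expR_ge0//.
    have -> : 1 - x ^+ 2 / N = 1 - (x / N) ^+ 2 *+ n.+1.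
      by rewrite -mulr_natr -/N; field; rewrite gt_eqF.
    by rewrite bernoulli_ineq// sqr_ge0 exprn_ile1.
  have -> : 1 - (x / N) ^+ 2 = (1 + x / N) * (1 - x / N) by ring.
  have z0 : 0 <= 1 - x / N by rewrite subr_ge0.
  have w0 : 0 <= 1 + x / N by rewrite addr_ge0.
  rewrite lerXn2r ?nnegrE ?mulr_ge0 ?expR_ge0//.
  rewrite mulrA ler_piMl// expRN mulrC ler_pdivrMr ?expR_gt0// mul1r.
  exact: expR_ge1Dx.
have g0 : g 0 = 0.
  rewrite /g ein0 oppr0 expR0 addr0 mulr1 subrr mul0r addr0 /f big1 ?subr0//.
  by move=> k _; rewrite mul0r subr0 expr1n subrr mul0r.
have fN : f N = \sum_(1 <= k < n.+2) k%:R^-1.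
  rewrite big_add1 big_mkord; apply: eq_bigr => k _.
  by rewrite divff ?gt_eqF// subrr expr0n subr0 mul1r.
rewrite mul0r g0 subr0 /g fN subr_ge0 => /le_trans; apply.
rewrite lerD2l ler_pdivrMr// mulVf ?gt_eqF//.
by rewrite gerBl mulr_ge0 ?expR_ge0 ?addr_ge0 ?ltW.
Qed.

(** [ein - ln] is nonincreasing, and by [harmonic_le_ein] it is at least
[gamma - 1 / N] at every positive integer [N]. *)
Lemma ein_ge_ln x : 0 < x -> ln x + euler_gamma R <= ein x.
Proof.
move=> x0; apply/ler_addgt0Pr => e e0.
pose n := maxn (Num.truncn x) (Num.truncn e^-1).
have xn : x <= n.+1%:R.
  by rewrite (le_trans (ltW (truncnS_gt x)))// ler_nat ltnS leq_maxl.
have en : n.+1%:R^-1 <= e.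
  rewrite invf_ple ?posrE ?ltr0n//.
  by rewrite (le_trans (ltW (truncnS_gt _)))// ler_nat ltnS leq_maxr.
pose f (z : R) := ein z - ln z; pose df (z : R) : R := expmom 0 (- z) - z^-1.
have dfP (z : R) : x <= z <= n.+1%:R -> is_derive z 1 f (df z).
  move=> /andP[xz _]; have z0 := lt_le_trans x0 xz.
  have de := is_derive_ein z; rewrite /f /df; derive_by R => //.
  by rewrite mulr1.
have : f n.+1%:R - f x <= 0 * (n.+1%:R - x).
  apply: MVT_le xn dfP _ => z /andP[xz _]; have z0 := lt_trans x0 xz.
  rewrite /df subr_le0 -(ler_pM2l z0) expmom0NE divff ?gt_eqF//.
rewrite mul0r subr_le0 /f.
have h1 := harmonic_le_ein n; have h2 := euler_gamma_le n => h3.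
by move: (\sum_(_ <= _ < _) _) (n.+1%:R^-1) en h1 h2 h3 => S d; lra.
Qed.

End EulerGamma.

(** * Averages over equidistributed points of a circle *)

Section CircleAverages.
Variable R : realType.
Implicit Types (f F : R -> R) (N : nat) (a x : R).

Definition angle N a (k : nat) : R := a + (pi *+ 2) * (k%:R / N%:R).

Definition circle_avg N a f : R := (\sum_(k < N) f (angle N a k)) / N%:R.

Lemma circle_avgD N a f g : circle_avg N a (fun x => f x + g x) = circle_avg N a f + circle_avg N a g.
Proof. by rewrite /circle_avg big_split mulrDl. Qed.

Lemma circle_avgZ N a c f : circle_avg N a (fun x => c * f x) = c * circle_avg N a f.
Proof. by rewrite /circle_avg -mulr_sumr mulrA. Qed.

Lemma circle_avg_cst N a c : (0 < N)%N -> circle_avg N a (fun=> c) = c.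
Proof.
move=> N0; rewrite /circle_avg sumr_const card_ord -[c *+ N]mulr_natr mulfK//.
by rewrite pnatr_eq0 -lt0n.
Qed.

Lemma circle_avg_ge0 N a f : (forall x, 0 <= f x) -> 0 <= circle_avg N a f.
Proof. by move=> f0; rewrite divr_ge0// sumr_ge0. Qed.

Lemma eq_circle_avg N a f g : f =1 g -> circle_avg N a f = circle_avg N a g.
Proof. by move=> fg; congr (_ / _); apply: eq_bigr. Qed.

Lemma der_circle_avg N a (f : R -> R -> R) (df : R -> R) (r : R) :
  (forall x, is_derive r 1 (f^~ x) (df x)) ->
  is_derive r 1 (fun r => circle_avg N a (f r)) (circle_avg N a df).
Proof.
move=> fdf; rewrite /circle_avg.
have ds : is_derive r 1 (fun z => \sum_(k < N) f z (angle N a k))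
   (\sum_(k < N) df (angle N a k)) by exact: der_sum.
by derive_by R; rewrite mulr0 addr0.
Qed.

(** The integral of a derivative over a period vanishes; for a Riemann sum with
[N] nodes the error is controlled by the second derivative. *)
Lemma circle_avg_derive_le N a F F1 F2 K : (0 < N)%N ->
  (forall x, F (x + pi *+ 2) = F x) ->
  (forall x, is_derive x 1 F (F1 x)) -> (forall x, is_derive x 1 F1 (F2 x)) ->
  (forall x, `|F2 x| <= K) ->
  `|circle_avg N a F1| <= pi *+ 2 * K / N%:R.
Proof.
move=> N0 FT dF dF1 F2K; have NR : 0 < N%:R :> R by rewrite ltr0n.
pose w : R := pi *+ 2 / N%:R.
have w0 : 0 < w by rewrite divr_gt0// mulrn_wgt0// pi_gt0.
have angS k : angle N a k.+1 = angle N a k + w.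
  by rewrite /angle /w -natr1; ring.
(* compare each arc with its linear approximation; the increments of [F] add up
   to [0] by periodicity *)
have step k : `|F (angle N a k.+1) - F (angle N a k) - w * F1 (angle N a k)|
              <= w * (K * w).
  set x := angle N a k; rewrite angS -/x.
  have xw : x <= x + w by rewrite lerDl ltW.
  have F1K y : x < y < x + w -> `|F1 y - F1 x| <= K * w.
    move=> /andP[xy yw]; have K0 : 0 <= K := le_trans (normr_ge0 _) (F2K x).
    apply: (@le_trans _ _ (K * (y - x))); last by rewrite ler_wpM2l//; lra.
    rewrite ler_norml -mulNr (MVT_ge (ltW xy) (fun z _ => dF1 z))/=; last first.
      by move=> z _; move: (F2K z); rewrite ler_norml => /andP[].
    rewrite (MVT_le (ltW xy) (fun z _ => dF1 z))// => z _.
    by move: (F2K z); rewrite ler_norml => /andP[].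
  have lo : (F1 x - K * w) * (x + w - x) <= F (x + w) - F x.
    apply: (MVT_ge xw (fun z _ => dF z)) => z /F1K.
    by rewrite ler_norml => /andP[]; lra.
  have hi : F (x + w) - F x <= (F1 x + K * w) * (x + w - x).
    apply: (MVT_le xw (fun z _ => dF z)) => z /F1K.
    by rewrite ler_norml => /andP[]; lra.
  have e : x + w - x = w by ring.
  by move: lo hi; rewrite e ler_norml => lo hi; apply/andP; split; lra.
have tel : \sum_(k < N) (F (angle N a k.+1) - F (angle N a k)) = 0.
  rewrite -(big_mkord xpredT (fun k => F (angle N a k.+1) - F (angle N a k))).
  rewrite telescope_sumr// /angle mul0r mulr0 addr0 divff ?gt_eqF// mulr1.
  by rewrite FT subrr.
have : `|\sum_(k < N) w * F1 (angle N a k)| <= \sum_(k < N) w * (K * w).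
  rewrite -normrN -[- _]add0r -{1}tel -sumrB.
  by rewrite (le_trans (ler_norm_sum _ _ _))// ler_sum.
rewrite sumr_const card_ord -mulr_sumr normrM (ger0_norm (ltW w0)).
rewrite -mulrnAr ler_pM2l// => h.
rewrite /circle_avg normrM normfV (ger0_norm (ltW NR)) ler_pdivrMr//.
rewrite (le_trans h)// -mulr_natr /w le_eqVlt; apply/orP; left; apply/eqP.
by field; rewrite gt_eqF.
Qed.

(** This is [|w + v| ^ 2] for complex numbers of moduli [b] and [r] with angle
[x] between them. *)
Definition circle_nsq (b r x : R) : R := b ^+ 2 + r ^+ 2 + 2 * b * r * cos x.

Lemma circle_nsq_bounds b r x (rho : R) : 0 <= b <= rho -> 0 <= r <= rho ->
  0 <= circle_nsq b r x <= 4 * rho ^+ 2.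
Proof.
move=> /andP[b0 br] /andP[r0 rr].
have c1 := cos_le1 x; have c2 := cos_geN1 x.
have br0 : 0 <= b * r by rewrite mulr_ge0.
have l1 : 0 <= (b * r) * (1 + cos x) by rewrite mulr_ge0//; lra.
have l2 : 0 <= (b * r) * (1 - cos x) by rewrite mulr_ge0//; lra.
have l3 := sqr_ge0 (b - r).
have l4 : b ^+ 2 <= rho ^+ 2 by rewrite lerXn2r ?nnegrE//; lra.
have l5 : r ^+ 2 <= rho ^+ 2 by rewrite lerXn2r ?nnegrE//; lra.
rewrite /circle_nsq; apply/andP; split; nra.
Qed.

Section RadialDerivative.
Variables (V V1 V2 : R -> R).
Hypothesis dV : forall t : R, is_derive t 1 V (V1 t).
Hypothesis dV1 : forall t : R, is_derive t 1 V1 (V2 t).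

Lemma der_radial (b r x : R) :
  is_derive r 1 (fun r => V (circle_nsq b r x))
    (V1 (circle_nsq b r x) * (2 * r + 2 * b * cos x)).
Proof. by rewrite /circle_nsq; derive_by R; rewrite /=; ring. Qed.

(** This is the derivative in [x] of [sin x * V1 (circle_nsq b r x)], the
angular part of the Laplacian of [V (|w| ^ 2)] up to a factor: its mean over
the circle is an error term of order [1 / N]. *)
Definition flux (b r x : R) : R :=
  cos x * V1 (circle_nsq b r x) - 2 * b * r * sin x ^+ 2 * V2 (circle_nsq b r x).

(** Polar form of the Laplacian. For a function [V (|w| ^ 2)] of the plane a
quarter of the Laplacian is [V' + t * V''] at [t = |w| ^ 2]. *)
Lemma der_radial2 (b r x : R) :
  is_derive r 1 (fun r => V1 (circle_nsq b r x) * (2 * r ^+ 2 + 2 * b * r * cos x))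
    (4 * r * (V1 (circle_nsq b r x) + circle_nsq b r x * V2 (circle_nsq b r x)) +
     2 * b * flux b r x).
Proof.
rewrite /flux sin2cos2 /circle_nsq; derive_by R; rewrite /=; ring.
Qed.

Lemma circle_avg_flux_le N a b r V3 (K rho : R) : (0 < N)%N ->
  (forall t : R, is_derive t 1 V2 (V3 t)) -> 0 <= b <= rho -> 0 <= r <= rho ->
  (forall t, 0 <= t <= 4 * rho ^+ 2 ->
     [/\ `|V1 t| <= K, `|V2 t| <= K & `|V3 t| <= K]) ->
  `|2 * b * circle_avg N a (flux b r)| <=
  (2 * rho * (pi *+ 2 * (K * (1 + 6 * rho ^+ 2 + 4 * rho ^+ 4)))) / N%:R.
Proof.
move=> N0 dV2 bb rb VK.
pose F x := sin x * V1 (circle_nsq b r x).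
pose F2 x := - (sin x * V1 (circle_nsq b r x)) -
   6 * (b * r) * (sin x * (cos x * V2 (circle_nsq b r x))) +
   4 * (b * r) ^+ 2 * (sin x ^+ 3 * V3 (circle_nsq b r x)).
have [b0 brho] := andP bb; have [r0 rrho] := andP rb.
have rho0 : 0 <= rho by exact: le_trans brho.
have K0 : 0 <= K.
  have [|] := VK 0; first by rewrite lexx mulr_ge0// sqr_ge0.
  by move=> /(le_trans (normr_ge0 _)).
have br : b * r <= rho ^+ 2 by rewrite expr2 ler_pM.
have br0 : 0 <= b * r by rewrite mulr_ge0.
suff H : `|circle_avg N a (flux b r)| <=
    pi *+ 2 * (K * (1 + 6 * rho ^+ 2 + 4 * rho ^+ 4)) / N%:R.
  rewrite normrM -[leRHS]mulrA ler_pM//.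
  by rewrite ger0_norm ?mulr_ge0// ler_wpM2l.
apply: (@circle_avg_derive_le N a F (flux b r) F2) => // x.
- by rewrite /F /circle_nsq sinD2pi cosD2pi.
- by rewrite /F /flux /circle_nsq; derive_by R; rewrite /=; ring.
- by rewrite /F2 /flux /circle_nsq; derive_by R; rewrite /=; ring.
have [v1 v2 v3] := VK _ (circle_nsq_bounds x bb rb).
have s1 := sin_max x; have c1 := cos_max x.
have e0 (s v : R) : `|s| <= 1 -> `|v| <= K -> `|s * v| <= K.
  by move=> s1' vK; rewrite normrM -[K]mul1r ler_pM.
have e1 := e0 _ _ s1 v1.
have e2 := e0 _ _ s1 (e0 _ _ c1 v2).
have e3 : `|sin x ^+ 3 * V3 (circle_nsq b r x)| <= K.
  by apply: e0 => //; rewrite normrX exprn_ile1.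
have br2 : (b * r) ^+ 2 <= rho ^+ 4.
  by rewrite -[4%N]/(2 * 2)%N exprM lerXn2r ?nnegrE ?exprn_ge0.
have e4 : `|6 * (b * r) * (sin x * (cos x * V2 (circle_nsq b r x)))|
    <= 6 * rho ^+ 2 * K.
  rewrite normrM ger0_norm ?mulr_ge0// ler_pM ?mulr_ge0//.
  by rewrite ler_wpM2l.
have e5 : `|4 * (b * r) ^+ 2 * (sin x ^+ 3 * V3 (circle_nsq b r x))|
    <= 4 * rho ^+ 4 * K.
  rewrite normrM ger0_norm ?mulr_ge0 ?exprn_ge0// ler_pM ?mulr_ge0 ?exprn_ge0//.
  by rewrite ler_wpM2l.
rewrite /F2 (le_trans (ler_normD _ _))//.
have -> : K * (1 + 6 * rho ^+ 2 + 4 * rho ^+ 4) =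
  (K + 6 * rho ^+ 2 * K) + 4 * rho ^+ 4 * K by ring.
by rewrite lerD// (le_trans (ler_normB _ _))// normrN lerD.
Qed.

End RadialDerivative.

End CircleAverages.

(** * The heat flow started at [t * ln t] *)

Section HeatFlow.
Variables (R : realType) (c : R).
Implicit Types (s t x : R).

(** For [c = 1 - gamma] this is the mean of [|w + sqrt s * g| ^ 2 *
ln (|w + sqrt s * g| ^ 2)] for a standard complex Gaussian [g] and
[|w| ^ 2 = t]. [heatGt] and [heatGs] are its derivatives in [t] and [s]. *)
Definition heatG s t : R :=
  (t + s) * (c + ein (t / s) + ln s) - t + t * expmom 0 (- (t / s)).

Definition heatGt s t : R := c + ein (t / s) + expmom 0 (- (t / s)) + ln s.

Definition heatGs s t : R := c + 1 + ein (t / s) + ln s.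

Lemma expmom01NE x :
  x * expmom 1 (- x) = expmom 0 (- x) + x * expmom 0 (- x) - 1 :> R.
Proof. by have := expmom_rec (- x); have := expmom0NE x; lra. Qed.

(** The time derivative [heatGs] is the Laplacian of [heatG], normalized as in
[der_radial2]. *)
Lemma heat_equation s t :
  heatGt s t + t * ((expmom 0 (- (t / s)) - expmom 1 (- (t / s))) / s)
  = heatGs s t.
Proof.
have H := expmom01NE (t / s).
rewrite mulrA mulrAC mulrBr H /heatGt /heatGs; ring.
Qed.

Lemma der_heatG (f g : R -> R) (z a b : R) : 0 < f z ->
  is_derive z 1 f a -> is_derive z 1 g b ->
  is_derive z 1 (fun z => heatG (f z) (g z))
    (heatGs (f z) (g z) * a + heatGt (f z) (g z) * b).
Proof.
move=> fz0 df dg; have dein := @is_derive_ein R.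
have fz1 : f z != 0 by rewrite gt_eqF.
rewrite /heatG /heatGs /heatGt; derive_by R.
set x := g z / f z; set m0 := expmom 0 (- x); set m1 := expmom 1 (- x).
(* the two sides differ by a multiple of this combination *)
have xm : x * m1 - m0 - x * m0 + 1 = 0 by rewrite /m1 expmom01NE -/m0; ring.
rewrite -[RHS](addrK ((a * x - b) * (x * m1 - m0 - x * m0 + 1))).
rewrite [X in _ = _ - _ * X]xm mulr0 subr0 /x.
rewrite -/x -/m0 -/m1 /x; move: (ein _) (ln _) => e l.
clear xm; move: m0 m1 => p q; move: (f z) (g z) fz1 => u v u0.
by field; rewrite ?u0.
Qed.

Lemma der_heatGt s t : 0 < s -> is_derive t 1 (heatGt s)
  ((expmom 0 (- (t / s)) - expmom 1 (- (t / s))) / s).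
Proof.
move=> s0; have dein := @is_derive_ein R.
by rewrite /heatGt; derive_by R; rewrite /=; ring.
Qed.

Lemma der_heatGtt s t : 0 < s ->
  is_derive t 1 (fun t => (expmom 0 (- (t / s)) - expmom 1 (- (t / s))) / s)
  ((expmom 2 (- (t / s)) - expmom 1 (- (t / s))) / s ^+ 2).
Proof.
by move=> s0; derive_by R; rewrite /=; field; rewrite gt_eqF.
Qed.

Lemma der_heatGs s t : 0 < s -> is_derive t 1 (heatGs s)
  (expmom 0 (- (t / s)) / s).
Proof.
move=> s0; have dein := @is_derive_ein R.
by rewrite /heatGs; derive_by R; rewrite /=; ring.
Qed.

Lemma der_heatGst s t : 0 < s ->
  is_derive t 1 (fun t => expmom 0 (- (t / s)) / s)
  (- expmom 1 (- (t / s)) / s ^+ 2).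
Proof. by move=> s0; derive_by R; rewrite /=; field; rewrite gt_eqF. Qed.

Lemma der_heatGstt s t : 0 < s ->
  is_derive t 1 (fun t => - expmom 1 (- (t / s)) / s ^+ 2)
  (expmom 2 (- (t / s)) / s ^+ 3).
Proof. by move=> s0; derive_by R; rewrite /=; field; rewrite gt_eqF. Qed.

(** The Laplacian of [heatGs] is the heat kernel [exp (- t / s) / s]. *)
Lemma heat_kernel_ge0 s t : 0 < s ->
  0 <= expmom 0 (- (t / s)) / s + t * (- expmom 1 (- (t / s)) / s ^+ 2).
Proof.
move=> s0; set x := t / s.
have -> : expmom 0 (- x) / s + t * (- expmom 1 (- x) / s ^+ 2) =
   (expmom 0 (- x) - x * expmom 1 (- x)) / s by rewrite /x; field; rewrite gt_eqF.
rewrite divr_ge0 ?(ltW s0)//.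
by have := expmom_rec (- x); rewrite mulNr => ->; exact: expR_ge0.
Qed.

End HeatFlow.

(** * One rotating vector costs at most its squared length in heat time *)

Section OneStep.
Variables (R : realType) (c delta top rho : R).
Hypotheses (delta0 : 0 < delta) (rho0 : 0 <= rho).
Implicit Types (s t x b r a : R).

Local Notation m j s t := (expmom j (- (t / s))).

Lemma expint_le x : `|expint x| <= expR `|x|.
Proof. exact/lim_pseries_le/fact_dominated_expint. Qed.

(** Every error term of the flow is controlled by these bounds, uniform in the
time [s] and over a bounded part of the plane. *)
Lemma heat_derivatives_bounded (T : R) : exists2 K, 0 <= K &
  forall s t, delta <= s <= top -> 0 <= t <= T ->
  [/\ `|heatGt c s t| <= K,
      `|(m 0 s t - m 1 s t) / s| <= K &
      `|(m 2 s t - m 1 s t) / s ^+ 2| <= K] /\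
  [/\ `|m 0 s t / s| <= K,
      `|- m 1 s t / s ^+ 2| <= K &
      `|m 2 s t / s ^+ 3| <= K].
Proof.
pose E := expR (T / delta); pose D := 1 + delta^-1.
pose K := `|c| + 2 * E + `|ln delta| + `|ln top| + 2 * E * D ^+ 3.
have E0 : 0 <= E by exact: expR_ge0.
have d1 : 0 <= delta^-1 by rewrite invr_ge0 ltW.
have D1 : 1 <= D by rewrite lerDl.
have K1 : 2 * E * D ^+ 3 <= K.
  by rewrite lerDr !addr_ge0// mulr_ge0.
have D00 : 0 <= D by rewrite (le_trans _ D1).
have D0 : 0 <= 2 * E * D ^+ 3 by apply: mulr_ge0; [exact: mulr_ge0|exact: exprn_ge0].
exists K; first exact: le_trans K1.
move=> s t /andP[ds st] /andP[t0 tT].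
have s0 : 0 < s := lt_le_trans delta0 ds.
have xE : expR `|- (t / s)| <= E.
  rewrite ler_expR normrN ger0_norm; last by rewrite divr_ge0// ltW.
  by rewrite ler_pM ?invr_ge0 ?(ltW s0)// lef_pV2.
have mE j : `|m j s t| <= E := le_trans (expmom_le _ _) xE.
have sD : s^-1 <= D.
  by rewrite (@le_trans _ _ delta^-1)// ?lef_pV2// lerDr.
have key j y : (j <= 3)%N -> `|y| <= 2 * E -> `|y / s ^+ j| <= K.
  move=> j3 yE; rewrite (le_trans _ K1)// normrM ler_pM//.
  rewrite ger0_norm ?invr_ge0 ?exprn_ge0 ?(ltW s0)// -exprVn.
  apply: (@le_trans _ _ (D ^+ j)).
    by rewrite lerXn2r ?nnegrE ?invr_ge0 ?(ltW s0)// D00.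
  by rewrite ler_weXn2l.
have key1 y : `|y| <= 2 * E -> `|y / s| <= K by move=> /(key 1 _ isT).
have mB i j : `|m i s t - m j s t| <= 2 * E.
  rewrite (le_trans (ler_normB _ _))//; have := mE i; have := mE j; lra.
have m2 j : `|m j s t| <= 2 * E by rewrite (le_trans (mE j)) ?ler_peMl// ler1n.
split; split.
- rewrite /heatGt /K.
  have l1 : `|ln s| <= `|ln delta| + `|ln top|.
    have l2 : ln delta <= ln s by rewrite ler_ln ?posrE.
    have l3 : ln s <= ln top by rewrite ler_ln ?posrE// (lt_le_trans s0).
    have n1 := ler_norm (ln top); have n2 := ler_norm (- ln delta).
    have n3 := normr_ge0 (ln top); have n4 := normr_ge0 (ln delta).
    by rewrite normrN in n2; rewrite ler_norml; apply/andP; split; lra.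
  have l2 : `|ein (t / s)| <= E.
    by rewrite /ein normrN (le_trans (expint_le _)).
  rewrite (le_trans (ler_normD _ _))//.
  rewrite (le_trans (lerD (ler_normD _ _) (lexx _)))//.
  rewrite (le_trans (lerD (lerD (ler_normD _ _) (lexx _)) (lexx _)))//.
  by have := mE 0; lra.
- exact: key1.
- exact: key.
- exact: key1.
- by apply: key; rewrite ?normrN.
- exact: key.
Qed.

(** Let [h] and [G] stand for the circle means of radius [r] of [heatGs] and
[heatG]. Up to errors [O (1 / N)], the heat equation gives
[(r * G')' = 4 * r * h], and [h] is nondecreasing in [r] because the Laplacian
of [heatGs] is nonnegative. Hence
[(2 * r ^ 2 * h - r * G')' = 2 * r ^ 2 * h' >= 0], so that
[G' <= 2 * r * h]: as a function of [r ^ 2] the mean of [heatG] is convex. *)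
Lemma heat_radial_ineq : exists2 C, 0 <= C &
  forall N s b r a, (0 < N)%N -> delta <= s <= top ->
  0 <= b <= rho -> 0 < r <= rho ->
  circle_avg N a (fun x => heatGt c s (circle_nsq b r x) * (2 * r + 2 * b * cos x)) -
  2 * r * circle_avg N a (fun x => heatGs c s (circle_nsq b r x)) <= C / N%:R.
Proof.
have [K K0 HK] := heat_derivatives_bounded (4 * rho ^+ 2).
pose C1 := 2 * rho * (pi *+ 2 * (K * (1 + 6 * rho ^+ 2 + 4 * rho ^+ 4))).
have pi0 : 0 <= pi :> R by exact: pi_ge0.
have C10 : 0 <= C1.
  have Z : 0 <= 1 + 6 * rho ^+ 2 + 4 * rho ^+ 4.
    by rewrite !addr_ge0// mulr_ge0// exprn_ge0.
  by apply: mulr_ge0; [exact: mulr_ge0|apply: mulr_ge0; [exact: mulrn_wge0|exact: mulr_ge0]].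
exists (2 * rho ^+ 2 * C1 + C1); first by rewrite addr_ge0// mulr_ge0// mulr_ge0// exprn_ge0.
move=> N s b r a N0 sb bb /andP[r0 rrho].
have NR : 0 < N%:R :> R by rewrite ltr0n.
have s0 : 0 < s by apply: lt_le_trans delta0 _; case/andP: sb.
pose H1 t := m 0 s t / s; pose H2 t := - m 1 s t / s ^+ 2.
pose G2 t := (m 0 s t - m 1 s t) / s.
have dH t := der_heatGs c t s0.
have dH1 t := der_heatGst t s0.
have dH2 t := der_heatGstt t s0.
have dG1 t := der_heatGt c t s0.
have dG11 t := der_heatGtt t s0.
have fluxH z : 0 <= z <= rho -> `|2 * b * circle_avg N a (flux H1 H2 b z)| <= C1 / N%:R.
  move=> zb; apply: (@circle_avg_flux_le R H1 H2 dH1 N a b z _ K rho N0 dH2 bb zb) => t tb.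
  by have [_ []] := HK s t sb tb.
have fluxG z : 0 <= z <= rho -> `|2 * b * circle_avg N a (flux (heatGt c s) G2 b z)| <= C1 / N%:R.
  move=> zb; apply: (@circle_avg_flux_le R (heatGt c s) G2 dG1 N a b z _ K rho N0 dG11 bb zb) => t tb.
  by have [[]] := HK s t sb tb.
pose h z := circle_avg N a (fun x => heatGs c s (circle_nsq b z x)).
pose P z := circle_avg N a (fun x => H1 (circle_nsq b z x) * (2 * z ^+ 2 + 2 * b * z * cos x)).
pose Q z := circle_avg N a (fun x => heatGt c s (circle_nsq b z x) * (2 * z ^+ 2 + 2 * b * z * cos x)).
have zero f : circle_avg N a (fun x => f x * (2 * 0 ^+ 2 + 2 * b * 0 * cos x)) = 0.
  by rewrite /circle_avg big1 ?mul0r// => k _; ring.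
have dP (z : R) : is_derive z 1 P (4 * z * circle_avg N a (fun x => H1 (circle_nsq b z x) +
    circle_nsq b z x * H2 (circle_nsq b z x)) + 2 * b * circle_avg N a (flux H1 H2 b z)).
  rewrite -!circle_avgZ -circle_avgD; apply: der_circle_avg => x.
  exact: (@der_radial2 R H1 H2 dH1 b z x).
have P_ge z : 0 <= z <= rho -> - (C1 / N%:R) * z <= P z.
  move=> /andP[z0 zr].
  have := MVT_ge z0 (fun y _ => dP y); rewrite /P zero !subr0; apply.
  move=> y /andP[y0 yz]; have yrho : 0 <= y <= rho by rewrite ltW//= (le_trans (ltW yz)).
  have := fluxH _ yrho; rewrite ler_norml => /andP[+ _].
  have : 0 <= 4 * y * circle_avg N a (fun x => H1 (circle_nsq b y x) +
      circle_nsq b y x * H2 (circle_nsq b y x)).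
    apply: mulr_ge0; first by rewrite mulr_ge0// ltW.
    by apply: circle_avg_ge0 => x; exact: heat_kernel_ge0.
  by lra.
have dh (z : R) : is_derive z 1 h
    (circle_avg N a (fun x => H1 (circle_nsq b z x) * (2 * z + 2 * b * cos x))).
  by apply: der_circle_avg => x; exact: (@der_radial R (heatGs c s) H1 dH b z x).
have dQ (z : R) : is_derive z 1 Q
    (4 * z * h z + 2 * b * circle_avg N a (flux (heatGt c s) G2 b z)).
  rewrite /h -!circle_avgZ -circle_avgD; apply: der_circle_avg => x.
  by rewrite -heat_equation; exact: (@der_radial2 R (heatGt c s) G2 dG1 b z x).
pose D z := 2 * z ^+ 2 * h z - Q z.
have dD (z : R) : is_derive z 1 D
    (2 * z * P z - 2 * b * circle_avg N a (flux (heatGt c s) G2 b z)).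
  have dhz := dh z; have dQz := dQ z.
  rewrite /D; derive_by R.
  have -> : P z = z * circle_avg N a (fun x => H1 (circle_nsq b z x) * (2 * z + 2 * b * cos x)).
    by rewrite -circle_avgZ; apply: eq_circle_avg => x; ring.
  by rewrite /=; ring.
pose C := 2 * rho ^+ 2 * C1 + C1.
have D_ge : - (C / N%:R) * r <= D r.
  have D0 : D 0 = 0 by rewrite /D /Q zero; ring.
  have := MVT_ge (ltW r0) (fun y _ => dD y); rewrite D0 !subr0; apply.
  move=> y /andP[y0 yr].
  have yrho : 0 <= y <= rho by rewrite ltW//= (le_trans (ltW yr)).
  have := fluxG _ yrho; rewrite ler_norml => /andP[_].
  have yP : y * (- (C1 / N%:R) * y) <= y * P y.
    by apply: ler_wpM2l; [exact: ltW|exact: (P_ge _ yrho)].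
  have yy : y ^+ 2 <= rho ^+ 2.
    by case/andP: yrho => y1 y2; rewrite lerXn2r ?nnegrE.
  have y2 : y ^+ 2 * (C1 / N%:R) <= rho ^+ 2 * (C1 / N%:R).
    by apply: ler_wpM2r => //; rewrite divr_ge0// ltW.
  have -> : C / N%:R = 2 * (rho ^+ 2 * (C1 / N%:R)) + C1 / N%:R by rewrite /C; ring.
  by move: (C1 / N%:R) yP y2 => e yP y2 hf; lra.
have -> : circle_avg N a (fun x => heatGt c s (circle_nsq b r x) * (2 * r + 2 * b * cos x)) -
  2 * r * h r = - (D r) / r.
  rewrite /D.
  have -> : Q r = r * circle_avg N a (fun x => heatGt c s (circle_nsq b r x) * (2 * r + 2 * b * cos x)).
    by rewrite -circle_avgZ; apply: eq_circle_avg => x; ring.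
  by field; rewrite gt_eqF.
by rewrite ler_pdivrMr// -/C lerNl -mulNr.
Qed.

(** The mean of [heatG c (s + a ^ 2 - r ^ 2)] over the circle of radius [r] is,
up to [O (1 / N)], nonincreasing in [r] by [heat_radial_ineq]; its values at
[r = 0] and [r = a] are the two sides. *)
Lemma heat_step : exists2 C, 0 <= C &
  forall N s b a0 a, (0 < N)%N -> delta <= s -> s + a ^+ 2 <= top ->
  0 <= b <= rho -> 0 <= a <= rho ->
  circle_avg N a0 (fun x => heatG c s (circle_nsq b a x)) <=
  heatG c (s + a ^+ 2) (b ^+ 2) + C / N%:R.
Proof.
have [C C0 HC] := heat_radial_ineq.
exists (C * rho); first by rewrite mulr_ge0.
move=> N s b a0 a N0 ds st bb /andP[a_ge0 arho].
have NR : 0 < N%:R :> R by rewrite ltr0n.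
pose f r := circle_avg N a0 (fun x => heatG c (s + a ^+ 2 - r ^+ 2) (circle_nsq b r x)).
pose df r := circle_avg N a0 (fun x =>
  heatGs c (s + a ^+ 2 - r ^+ 2) (circle_nsq b r x) * (- (2 * r)) +
  heatGt c (s + a ^+ 2 - r ^+ 2) (circle_nsq b r x) * (2 * r + 2 * b * cos x)).
have r2 r : 0 <= r <= a -> 0 <= r ^+ 2 <= a ^+ 2.
  by move=> /andP[r0 ra]; rewrite exprn_ge0// lerXn2r ?nnegrE.
have dfP (r : R) : 0 <= r <= a -> is_derive r 1 f (df r).
  move=> /r2/andP[r20 r2a]; apply: der_circle_avg => x; apply: der_heatG.
  - by rewrite (lt_le_trans delta0)// (le_trans ds)//; lra.
  - by derive_by R; rewrite /=; ring.
  - by rewrite /circle_nsq; derive_by R; rewrite /=; ring.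
have := @MVT_le R f df 0 a (C / N%:R) a_ge0 dfP.
have -> : f 0 = heatG c (s + a ^+ 2) (b ^+ 2).
  rewrite /f expr0n subr0 -[RHS](circle_avg_cst a0 _ N0); apply: eq_circle_avg => x.
  by rewrite /circle_nsq expr0n mulr0 mul0r !addr0.
have -> : f a = circle_avg N a0 (fun x => heatG c s (circle_nsq b a x)).
  by apply: eq_circle_avg => x; rewrite addrK.
rewrite subr0 -lerBlDl => H; apply: le_trans (H _) _ => [r /andP[r0 ra]|].
  rewrite /df circle_avgD addrC.
  have -> : circle_avg N a0 (fun x => heatGs c (s + a ^+ 2 - r ^+ 2) (circle_nsq b r x) * (- (2 * r)))
     = - (2 * r * circle_avg N a0 (fun x => heatGs c (s + a ^+ 2 - r ^+ 2) (circle_nsq b r x))).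
    by rewrite -[RHS]mulNr -circle_avgZ; apply: eq_circle_avg => x; rewrite mulrC.
  apply: HC => //; last by rewrite r0 (le_trans (ltW ra)).
  have /r2/andP[] : 0 <= r <= a by rewrite !ltW.
  by move=> ? ?; apply/andP; split; lra.
by rewrite mulrAC; apply: ler_wpM2r; [rewrite invr_ge0 ltW|exact: ler_wpM2l].
Qed.

End OneStep.

(** * Random roots of unity *)

Section RootsOfUnity.
Variable R : realType.
Local Open Scope complex_scope.
Local Notation C := R[i].
Implicit Types (w b z : C) (x : R).

Definition expi x : C := cos x +i* sin x.

Definition rootC N (k : nat) : C := expi (pi *+ 2 * (k%:R / N%:R)).

Lemma normc_ge0 z : 0 <= normc z.
Proof. by case: z => u v; exact: sqrtr_ge0. Qed.

Lemma normc_sqr z : normc z ^+ 2 = complex.Re z ^+ 2 + complex.Im z ^+ 2.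
Proof. by case: z => u v /=; rewrite sqr_sqrtr// addr_ge0// sqr_ge0. Qed.

Lemma normc_expi x : normc (expi x) = 1.
Proof. by rewrite /expi /= cos2Dsin2 sqrtr1. Qed.

Lemma polar z : exists x, z = (normc z * cos x) +i* (normc z * sin x).
Proof.
have [->|z0] := eqVneq z 0; first by exists 0; rewrite normc0 !mul0r.
have n0 : 0 < normc z.
  rewrite lt_neqAle normc_ge0 andbT eq_sym; apply: contra z0 => /eqP/eq0_normc ->.
  exact: eqxx.
case: z z0 n0 => u v z0; set n := normc _ => n0.
have uvn : u ^+ 2 + v ^+ 2 = n ^+ 2 by rewrite [RHS]normc_sqr.
have un : -1 <= u / n <= 1.
  rewrite -ler_norml normrM normfV (ger0_norm (ltW n0)) ler_pdivrMr// mul1r.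
  rewrite -(ler_pXn2r (_ : 0 < 2)%N) ?nnegrE ?(ltW n0)//.
  by rewrite real_normK ?num_real// -uvn lerDl sqr_ge0.
have c1 : n * cos (acos (u / n)) = u by rewrite acosK// mulrC divfK// gt_eqF.
have s1 : n * sin (acos (u / n)) = `|v|.
  have {1}-> : n = Num.sqrt (n ^+ 2) by rewrite sqrtr_sqr ger0_norm// ltW.
  rewrite sin_acos// -sqrtrM ?sqr_ge0//.
  rewrite -sqrtr_sqr; congr Num.sqrt.
  have -> : v ^+ 2 = n ^+ 2 - u ^+ 2 by rewrite -uvn addrAC subrr add0r.
  by field; rewrite gt_eqF.
have [v0|v0] := leP 0 v.
  by exists (acos (u / n)); rewrite c1 s1 ger0_norm.
exists (- acos (u / n)); rewrite cosN sinN mulrN c1 s1 ltr0_norm//.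
by rewrite opprK.
Qed.

(** By polar coordinates for [w] and [b], rotating [b] moves only the angle
between them. *)
Lemma normc_rotate w b : exists a, forall x,
  normc (w + expi x * b) ^+ 2 = circle_nsq (normc w) (normc b) (a + x).
Proof.
have [u wE] := polar w; have [v bE] := polar b.
exists (v - u) => x.
rewrite normc_sqr {1 2}wE {1 2}bE /circle_nsq /=.
have -> : v - u + x = (v + x) - u by ring.
rewrite cosB cosD sinD.
have hu := cos2Dsin2 u; have hv := cos2Dsin2 v; have hx := cos2Dsin2 x.
apply: (@eq_trans _ _ (normc w ^+ 2 * (cos u ^+ 2 + sin u ^+ 2) +
  normc b ^+ 2 * ((cos x ^+ 2 + sin x ^+ 2) * (cos v ^+ 2 + sin v ^+ 2)) +
  2 * normc w * normc b *
   ((cos v * cos x - sin v * sin x) * cos u + (sin v * cos x + cos v * sin x) * sin u))).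
  by ring.
by rewrite hu hv hx !mulr1.
Qed.

Definition root_avg N (f : C -> R) : R := (\sum_(k < N) f (rootC N k)) / N%:R.

Lemma root_avg_rotate N (f : R -> R) w b : exists a,
  root_avg N (fun z => f (normc (w + z * b) ^+ 2)) =
  circle_avg N a (fun x => f (circle_nsq (normc w) (normc b) x)).
Proof.
have [a rot] := normc_rotate w b; exists a.
by rewrite /root_avg /circle_avg; congr (_ / _); apply: eq_bigr => k _; rewrite rot.
Qed.

Lemma sum_cos_angle N a : (1 < N)%N -> \sum_(k < N) cos (angle N a k) = 0 :> R.
Proof.
move=> N1; have NR : 0 < N%:R :> R by rewrite ltr0n ltnW.
have sN : 0 < sin (pi / N%:R) :> R.
  apply: sin_gt0_pi; rewrite divr_gt0 ?pi_gt0//= ltr_pdivrMr// ltr_pMr ?pi_gt0//.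
  by rewrite ltr1n.
(* multiplied by [2 * sin h], the sum telescopes *)
pose h : R := pi / N%:R; pose g k := sin (angle N a k - h).
have step k : 2 * sin h * cos (angle N a k) = g k.+1 - g k.
  rewrite /g; have -> : angle N a k.+1 - h = angle N a k + h.
    by rewrite /angle /h -natr1; ring.
  by rewrite sinD sinB; ring.
have : 2 * sin h * \sum_(k < N) cos (angle N a k) = 0.
  rewrite mulr_sumr; under eq_bigr do rewrite step.
  rewrite -(big_mkord xpredT (fun k => g k.+1 - g k)) telescope_sumr//.
  rewrite /g /angle mul0r mulr0 addr0 divff ?gt_eqF// mulr1.
  by rewrite addrAC sinD2pi subrr.
by move/eqP; rewrite !mulf_eq0 pnatr_eq0 (gt_eqF sN)/= => /eqP.
Qed.

Lemma root_avg_normc2 N w b : (1 < N)%N ->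
  root_avg N (fun z => normc (w + z * b) ^+ 2) = normc w ^+ 2 + normc b ^+ 2.
Proof.
move=> N1; have NR : 0 < N%:R :> R by rewrite ltr0n ltnW.
have [a ->] := root_avg_rotate N id w b.
rewrite /circle_avg /circle_nsq big_split/= -mulr_sumr sum_cos_angle// mulr0 addr0.
by rewrite sumr_const card_ord -[_ *+ N]mulr_natr mulfK// gt_eqF.
Qed.

Lemma root_avgD N f g : root_avg N (fun z => f z + g z) = root_avg N f + root_avg N g.
Proof. by rewrite /root_avg big_split mulrDl. Qed.

Lemma root_avgZ N c f : root_avg N (fun z => c * f z) = c * root_avg N f.
Proof. by rewrite /root_avg -mulr_sumr mulrA. Qed.

Lemma root_avg_cst N c : (0 < N)%N -> root_avg N (fun=> c) = c.
Proof.
move=> N0; rewrite /root_avg sumr_const card_ord -[c *+ N]mulr_natr mulfK//.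
by rewrite pnatr_eq0 -lt0n.
Qed.

Lemma normc_rootC N k : normc (rootC N k) = 1.
Proof. exact: normc_expi. Qed.

Lemma ler_root_avg N f g : (forall z, normc z = 1 -> f z <= g z) ->
  root_avg N f <= root_avg N g.
Proof.
move=> fg; rewrite ler_wpM2r ?invr_ge0// ler_sum// => k _.
by rewrite fg// normc_rootC.
Qed.

Lemma eq_root_avg N f g : f =1 g -> root_avg N f = root_avg N g.
Proof. by move=> fg; congr (_ / _); apply: eq_bigr. Qed.

(** The expectation over [n] independent uniform [N]-th roots of unity, as an
iterated average: no side condition is needed for its linearity. *)
Fixpoint signE N n (f : seq C -> R) : R :=
  if n is n'.+1 then root_avg N (fun z => signE N n' (fun s => f (z :: s)))
  else f [::].

Lemma eq_signE N n f g : f =1 g -> signE N n f = signE N n g.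
Proof.
elim: n f g => [|n IH] f g fg /=; first exact: fg.
by apply: eq_root_avg => z; apply: IH => s; exact: fg.
Qed.

Lemma signED N n f g : signE N n (fun s => f s + g s) = signE N n f + signE N n g.
Proof.
elim: n f g => [//|n IH] f g /=; rewrite -root_avgD.
by apply: eq_root_avg => z; exact: IH.
Qed.

Lemma signEZ N n c f : signE N n (fun s => c * f s) = c * signE N n f.
Proof.
elim: n f => [//|n IH] f /=; rewrite -root_avgZ.
by apply: eq_root_avg => z; exact: IH.
Qed.

Lemma signE_cst N n c : (0 < N)%N -> signE N n (fun=> c) = c.
Proof.
move=> N0; elim: n => [//|n IH] /=; rewrite -[RHS](root_avg_cst c N0).
by apply: eq_root_avg => z.
Qed.

Lemma signE_sum N n (I : Type) (r : seq I) (f : I -> seq C -> R) : (0 < N)%N ->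
  signE N n (fun s => \sum_(i <- r) f i s) = \sum_(i <- r) signE N n (f i).
Proof.
move=> N0; elim: r => [|i r IH].
  rewrite big_nil -[RHS](signE_cst n 0 N0).
  by apply: eq_signE => s; rewrite big_nil.
rewrite big_cons -IH -signED; apply: eq_signE => s.
by rewrite big_cons.
Qed.

Lemma ler_signE N n f g :
  (forall s, size s = n -> (forall z, z \in s -> normc z = 1) -> f s <= g s) ->
  signE N n f <= signE N n g.
Proof.
elim: n f g => [|n IH] f g fg /=; first exact: fg.
apply: ler_root_avg => z z1; apply: IH => s sn s1.
apply: fg; first by rewrite /= sn.
by move=> y; rewrite inE => /predU1P[->|/s1].
Qed.

Definition signed_sum n (b : nat -> C) (s : seq C) : C :=
  \sum_(i < n) s`_i * b i.

Lemma signed_sum_cons n (b : nat -> C) z (s : seq C) : signed_sum n.+1 b (z :: s) = z * b 0 + signed_sum n (b \o succn) s.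
Proof. by rewrite /signed_sum big_ord_recl. Qed.

Definition sqsum n (b : nat -> C) : R := \sum_(i < n) normc (b i) ^+ 2.

Lemma sqsum_recl n (b : nat -> C) : sqsum n.+1 b = normc (b 0) ^+ 2 + sqsum n (b \o succn).
Proof. by rewrite /sqsum big_ord_recl. Qed.

Lemma sqsum_ge0 n (b : nat -> C) : 0 <= sqsum n b.
Proof. by apply: sumr_ge0 => i _; rewrite exprn_ge0 ?normc_ge0. Qed.

Lemma signE_normc2 N n w (b : nat -> C) : (1 < N)%N ->
  signE N n (fun s => normc (w + signed_sum n b s) ^+ 2) = normc w ^+ 2 + sqsum n b.
Proof.
move=> N1; elim: n w b => [|n IH] w b /=.
  by rewrite /signed_sum /sqsum !big_ord0 !addr0.
rewrite sqsum_recl addrA -(root_avg_normc2 w (b 0) N1).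
rewrite -[X in _ = _ + X](root_avg_cst _ (ltnW N1)) -root_avgD.
apply: eq_root_avg => z; rewrite -IH; apply: eq_signE => s.
by rewrite signed_sum_cons addrA.
Qed.

(** The random terms are added one at a time, each trading its squared length
for heat time. *)
Lemma heat_chain (c delta top rho K : R) N :
  (forall s b a0 a : R, delta <= s -> s + a ^+ 2 <= top ->
    0 <= b <= rho -> 0 <= a <= rho ->
    circle_avg N a0 (fun x => heatG c s (circle_nsq b a x)) <=
    heatG c (s + a ^+ 2) (b ^+ 2) + K) ->
  (0 < N)%N ->
  forall n w (b : nat -> C) (s : R), delta <= s -> s + sqsum n b <= top ->
  normc w + \sum_(i < n) normc (b i) <= rho ->
  signE N n (fun t => heatG c s (normc (w + signed_sum n b t) ^+ 2)) <=
  heatG c (s + sqsum n b) (normc w ^+ 2) + n%:R * K.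
Proof.
move=> step N0; elim=> [|n IH] w b s ds st wr /=.
  by rewrite /signed_sum /sqsum !big_ord0 !addr0 mul0r addr0.
have wr1 : normc w + normc (b 0) + \sum_(i < n) normc (b i.+1) <= rho.
  by move: wr; rewrite big_ord_recl addrA.
have S0 : 0 <= \sum_(i < n) normc (b i.+1) by apply: sumr_ge0 => i _; exact: normc_ge0.
have w0 := normc_ge0 w; have b0 := normc_ge0 (b 0).
apply: (@le_trans _ _ (root_avg N (fun z =>
    heatG c (s + sqsum n (b \o succn)) (normc (w + z * b 0) ^+ 2) + n%:R * K))).
  apply: ler_root_avg => z z1.
  have -> : signE N n (fun t => heatG c s (normc (w + signed_sum n.+1 b (z :: t)) ^+ 2))
     = signE N n (fun t => heatG c s (normc ((w + z * b 0) + signed_sum n (b \o succn) t) ^+ 2)).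
    by apply: eq_signE => t; rewrite signed_sum_cons addrA.
  apply: IH => //.
    by move: st; rewrite sqsum_recl; have := sqr_ge0 (normc (b 0)); lra.
  rewrite (le_trans _ wr1)// lerD2r (le_trans (le_normcD _ _))//.
  by rewrite normcM z1 mul1r.
rewrite root_avgD root_avg_cst//.
have -> : n.+1%:R * K = K + n%:R * K by rewrite -natr1; ring.
rewrite addrA lerD2r.
have [a0 ->] := root_avg_rotate N (heatG c (s + sqsum n (b \o succn))) w (b 0).
rewrite sqsum_recl [_ ^+ 2 + sqsum _ _]addrC addrA.
apply: step.
- by rewrite (le_trans ds)// lerDl sqsum_ge0.
- by move: st; rewrite sqsum_recl; lra.
- by rewrite w0; lra.
- by rewrite b0; lra.
Qed.

End RootsOfUnity.

(** * The entropy inequality and the Khinchine inequality near exponent 2 *)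

Section Entropy.
Variable R : realType.
Local Notation C := (complex R).
Local Notation gamma := (euler_gamma R).
Implicit Types (t x : R).

Lemma ein_ge0 x : 0 <= x -> 0 <= ein x.
Proof.
move=> x0; suff: 0 * (x - 0) <= ein x - ein 0 by rewrite mul0r ein0 subr0.
apply: (MVT_ge x0 (fun z _ => is_derive_ein z)) => z /andP[z0 _].
rewrite -(pmulr_rge0 _ z0) expmom0NE subr_ge0.
by rewrite -[1]expR0 ler_expR oppr_le0 ltW.
Qed.

(** Starting the flow at time [delta] instead of [0] loses only a term that
vanishes with [delta]. For [t >= delta] this is where [gamma] enters, through
[ein_ge_ln]. *)
Lemma xlnx_le_heatG (delta t : R) : 0 < delta -> 0 <= t ->
  t * ln t <= heatG (1 - gamma) delta t + (delta - delta * ln delta).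
Proof.
move=> d0 t0; have g1 := euler_gamma_le1 R.
pose x := t / delta.
have x0 : 0 <= x by rewrite divr_ge0// ltW.
have tE : 0 <= t * expmom 0 (- x).
  have -> : t * expmom 0 (- x) = delta * (x * expmom 0 (- x)).
    by rewrite /x; field; rewrite gt_eqF.
  by rewrite expmom0NE mulr_ge0 ?(ltW d0)// subr_ge0 -[leRHS]expR0 ler_expR oppr_le0.
rewrite /heatG -/x.
have [td|dt] := ltP t delta.
  have e0 := ein_ge0 x0.
  have l1 : t * ln t <= t * ln delta.
    have [->|t1] := eqVneq t 0; first by rewrite !mul0r.
    have tgt0 : 0 < t by rewrite lt_neqAle eq_sym t1.
    by rewrite ler_wpM2l// ler_ln ?posrE// ltW.
  have l2 : 0 <= (t + delta) * (1 - gamma + ein x).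
    by apply: mulr_ge0; [rewrite addr_ge0// ltW|lra].
  lra.
have tgt0 : 0 < t := lt_le_trans d0 dt.
have e0 := ein_ge_ln (divr_gt0 tgt0 d0).
have lx : ln (t / delta) = ln t - ln delta by rewrite ln_div ?posrE.
have ld : ln delta <= ln t by rewrite ler_ln ?posrE.
have l2 : 0 <= (t + delta) * (ein x + ln delta - gamma - ln t).
  by apply: mulr_ge0; [rewrite addr_ge0// ltW|move: e0; rewrite lx -/x; lra].
have l3 : delta * ln delta <= delta * ln t by rewrite ler_wpM2l// ltW.
have l4 := ltW d0.
lra.
Qed.

Lemma heatG0 (c s : R) : heatG c s 0 = s * (c + ln s).
Proof. by rewrite /heatG !mul0r add0r ein0 addr0 subr0 addr0. Qed.

(** A rate for [x * ln x --> 0], with [x = eta ^ 2] to avoid square roots. *)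
Lemma sqr_ln_sqr (eta : R) : 0 < eta -> - (eta ^+ 2 * ln (eta ^+ 2)) <= 2 * eta.
Proof.
move=> e0; rewrite lnXn// mulrnAr expr2 -mulrA.
have : ln eta^-1 <= eta^-1 by rewrite ltW// ln_sublinear// invr_gt0.
rewrite lnV ?posrE// -(ler_pM2l e0) divff ?gt_eqF// => h.
have -> : - (eta * (eta * ln eta) *+ 2) = 2 * eta * (eta * - ln eta) by ring.
by rewrite -[leRHS]mulr1 ler_wpM2l// mulr_ge0// ltW.
Qed.

(** The heat flow ends at [heatG c (1 + delta) 0], which tends to [c] with
[delta]. *)
Lemma sign_entropy n (eps : R) : 0 < eps -> exists2 N, (1 < N)%N &
  forall b : nat -> C, sqsum n b = 1 ->
  signE N n (fun s => normc (signed_sum n b s) ^+ 2 * ln (normc (signed_sum n b s) ^+ 2)) <=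
  1 - gamma + eps.
Proof.
move=> eps0; set c := 1 - gamma.
have c0 : 0 <= c by rewrite subr_ge0 euler_gamma_le1.
(* [eta = sqrt delta] keeps the losses of order [delta] and [sqrt delta] below
   [eps / 2], and [N] the loss [n * K / N] *)
pose M := 2 * (c + 5); have M0 : 0 < M by rewrite mulr_gt0//; lra.
pose eta := Num.min 1 (eps / M).
have eta0 : 0 < eta by rewrite lt_min ltr01 divr_gt0.
have eta1 : eta <= 1 by rewrite ge_min lexx.
have etaM : eta * M <= eps by rewrite -ler_pdivlMr// ge_min lexx orbT.
pose delta := eta ^+ 2; have d0 : 0 < delta by rewrite exprn_gt0.
have de : delta <= eta by rewrite /delta expr2 ler_piMl// ltW.
have [K K0 step] := heat_step c 2 d0 (ler0n R n).
pose N := (maxn 1 (Num.truncn (n%:R * K / (eps / 2)))).+1.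
exists N => // [|b b1]; first by rewrite ltnS leq_maxl.
have NR : 0 < N%:R :> R by rewrite ltr0n.
have nK : n%:R * (K / N%:R) <= eps / 2.
  rewrite mulrA ler_pdivrMr// [leRHS]mulrC -ler_pdivrMr ?divr_gt0//.
  by rewrite (le_trans (ltW (truncnS_gt _)))// ler_nat ltnS leq_maxr.
have bi (i : 'I_n) : normc (b i) <= 1.
  rewrite -(@ler_pXn2r _ 2) ?nnegrE ?normc_ge0// expr1n -b1 /sqsum (bigD1 i)//=.
  by rewrite lerDl sumr_ge0// => j _; rewrite exprn_ge0 ?normc_ge0.
have bn : normc (0 : C) + \sum_(i < n) normc (b i) <= n%:R.
  rewrite normc0 add0r -[n in leRHS]card_ord -sumr_const ler_sum//.
have dS : delta + sqsum n b <= 2 by rewrite b1; lra.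
have := heat_chain (fun s b a0 a => @step N s b a0 a isT) isT (lexx delta) dS bn.
set E := signE _ _ _ => chain.
have : signE N n (fun s => normc (signed_sum n b s) ^+ 2 * ln (normc (signed_sum n b s) ^+ 2)) <=
       E + (delta - delta * ln delta).
  rewrite -[X in _ <= _ + X](@signE_cst R N n _ isT) /E -signED.
  apply: ler_signE => s _ _; rewrite add0r; apply: xlnx_le_heatG => //.
  by rewrite exprn_ge0 ?normc_ge0.
move=> /le_trans; apply.
have ln1d : ln (1 + delta) <= delta by rewrite le_ln1Dx//; lra.
have dl := sqr_ln_sqr eta0; rewrite -/delta in dl.
move: chain; rewrite b1 normc0 expr0n/= heatG0 => chain.
have h : (delta + 1) * (c + ln (delta + 1)) <= (delta + 1) * (c + delta).
  by rewrite ler_wpM2l// ?lerD2l; [lra|rewrite addrC].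
have dd : delta * delta <= eta by rewrite (le_trans _ de)// ler_piMl//; lra.
have dc : delta * c <= eta * c by rewrite ler_wpM2r.
have e2 : eta * M = 2 * (eta * c) + 10 * eta by rewrite /M; ring.
lra.
Qed.

Definition khin_const (kappa l : R) : R := expR ((l^-1 - 2^-1) * kappa).

(** Jensen's inequality for the weights [|S| ^ 2], through the tangent line of
the exponential at [- (1 - l / 2) * kappa]. The number [N] of roots serves all
the exponents [l] and all the coefficients [b]. *)
Lemma khinchine n (kappa : R) : 1 - gamma < kappa -> exists2 N, (1 < N)%N &
  forall (l : R) (b : nat -> C), 0 < l <= 2 ->
  (sqsum n b) `^ (l / 2) <=
  khin_const kappa l `^ l * signE N n (fun s => normc (signed_sum n b s) `^ l).
Proof.
move=> gk; have e0 : 0 < kappa - (1 - gamma) by rewrite subr_gt0.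
have k0 : 0 < kappa by rewrite (le_lt_trans _ gk)// subr_ge0 euler_gamma_le1.
have [N N1 ent] := sign_entropy n e0; exists N => // l b /andP[l0 l2].
pose a := 1 - l / 2; have a0 : 0 <= a by rewrite /a; lra.
have -> : khin_const kappa l `^ l = expR (a * kappa).
  rewrite /khin_const -expRM /a; congr expR; field.
  by rewrite gt_eqF.
have main b' : sqsum n b' = 1 ->
    1 <= expR (a * kappa) * signE N n (fun s => normc (signed_sum n b' s) `^ l).
  move=> b1; rewrite -ler_pdivrMl ?expR_gt0// mulr1 -expRN.
  have lb t : 0 <= t -> expR (- (a * kappa)) *
      ((1 + a * kappa) * t ^+ 2 + - a * (t ^+ 2 * ln (t ^+ 2))) <= t `^ l.
    rewrite le_eqVlt => /predU1P[<-|t0].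
      by rewrite expr0n/= !mul0r !mulr0 addr0 mulr0 powR_ge0.
    rewrite /powR gt_eqF//; have t20 : 0 < t ^+ 2 by rewrite exprn_gt0.
    have -> : l * ln t = ln (t ^+ 2) + (- (a * kappa) + (a * kappa - a * ln (t ^+ 2))).
      by rewrite lnXn// /a; field.
    rewrite expRD lnK ?posrE// expRD [leRHS]mulrCA ler_wpM2l ?expR_ge0//.
    have := expR_ge1Dx (a * kappa - a * ln (t ^+ 2)).
    by move=> /(ler_wpM2l (ltW t20)); apply: le_trans; rewrite le_eqVlt; apply/orP; left; apply/eqP; ring.
  apply: (@le_trans _ _ (signE N n (fun s => expR (- (a * kappa)) *
      ((1 + a * kappa) * normc (signed_sum n b' s) ^+ 2 +
       - a * (normc (signed_sum n b' s) ^+ 2 * ln (normc (signed_sum n b' s) ^+ 2)))))); last first.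
    by apply: ler_signE => s _ _; exact: lb (normc_ge0 _).
  rewrite signEZ signED !signEZ.
  have := @signE_normc2 R N n 0 b' N1.
  rewrite normc0 expr0n/= add0r b1; under eq_signE do rewrite add0r.
  move=> ->; rewrite mulr1 ler_peMr ?expR_ge0//.
  have := ler_wpM2l a0 (ent _ b1); rewrite mulNr.
  have -> : 1 - gamma + (kappa - (1 - gamma)) = kappa by ring.
  by move=> h; lra.
have [S0|S0] := eqVneq (sqsum n b) 0.
  rewrite S0 powR0 ?mulf_neq0 ?gt_eqF// mulr_ge0 ?expR_ge0//.
  rewrite -(@signE_cst R N n 0 (ltnW N1)); apply: ler_signE => s _ _.
  exact: powR_ge0.
have Sgt0 : 0 < sqsum n b by rewrite lt_neqAle eq_sym S0 sqsum_ge0.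
pose r := Num.sqrt (sqsum n b).
have r0 : 0 < r by rewrite sqrtr_gt0.
have r2 : r ^+ 2 = sqsum n b by rewrite sqr_sqrtr// ltW.
pose b' i : C := (r^-1)%:C%C * b i.
have nr : normc (r^-1)%:C%C = r^-1.
  by rewrite /= expr0n addr0 sqrtr_sqr ger0_norm// invr_ge0 ltW.
have b'1 : sqsum n b' = 1.
  rewrite /sqsum (eq_bigr (fun i : 'I_n => r^-1 ^+ 2 * normc (b i) ^+ 2)).
    by rewrite -mulr_sumr -/(sqsum n b) -r2 -exprMn mulVf ?gt_eqF// expr1n.
  by move=> i _; rewrite /b' normcM nr exprMn.
have := main _ b'1.
have -> : signE N n (fun s => normc (signed_sum n b' s) `^ l) =
    r^-1 `^ l * signE N n (fun s => normc (signed_sum n b s) `^ l).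
  rewrite -signEZ; apply: eq_signE => s.
  have -> : signed_sum n b' s = (r^-1)%:C%C * signed_sum n b s.
    by rewrite /signed_sum mulr_sumr; apply: eq_bigr => i _; rewrite /b' mulrCA.
  by rewrite normcM nr powRM ?normc_ge0// invr_ge0 ltW.
have rl : 0 < r `^ l by rewrite powR_gt0.
rewrite -(ler_pM2l rl) mulr1 => /le_trans.
have -> : sqsum n b `^ (l / 2) = r `^ l.
  by rewrite -r2 -powR_mulrn ?(ltW r0)// -powRrM; congr (_ `^ _); field.
apply; rewrite le_eqVlt; apply/orP; left; apply/eqP.
rewrite mulrCA; congr (_ * _); rewrite mulrA -powRM ?invr_ge0 ?(ltW r0)//.
by rewrite divff ?gt_eqF// powR1 mul1r.
Qed.

End Entropy.

(** * Finite Hoelder and Minkowski inequalities *)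

Section FiniteInequalities.
Variable R : realType.
Implicit Types (x y t p q : R).

Lemma young_powR x y t : 0 <= x -> 0 <= y -> 0 < t < 1 ->
  x `^ t * y `^ (1 - t) <= t * x + (1 - t) * y.
Proof.
move=> x0 y0 /andP[t0 t1]; have t1' : 0 < 1 - t by rewrite subr_gt0.
have := @conjugate_powR R (x `^ t) (y `^ (1 - t)) t^-1 (1 - t)^-1.
rewrite !powR_ge0 !invr_gt0 !invrK t0 t1' addrCA subrr addr0 => /(_ isT isT isT isT erefl).
rewrite -!powRrM !divff ?gt_eqF// !powRr1//.
by rewrite [x * t]mulrC [y * _]mulrC.
Qed.

Lemma holder_sum (I : Type) (r : seq I) (f g : I -> R) t : 0 <= t <= 1 ->
  (forall i, 0 <= f i) -> (forall i, 0 <= g i) ->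
  \sum_(i <- r) f i `^ t * g i `^ (1 - t) <=
  (\sum_(i <- r) f i) `^ t * (\sum_(i <- r) g i) `^ (1 - t).
Proof.
move=> /andP[t0 t1] f0 g0.
have F0 : 0 <= \sum_(i <- r) f i by exact: sumr_ge0.
have G0 : 0 <= \sum_(i <- r) g i by exact: sumr_ge0.
move: t0; rewrite le_eqVlt => /predU1P[<-|t0].
  rewrite subr0 powRr0 mul1r powRr1// ler_sum// => i _.
  by rewrite powRr0 mul1r powRr1.
move: t1; rewrite le_eqVlt => /predU1P[->|t1].
  rewrite subrr powRr0 mulr1 powRr1// ler_sum// => i _.
  by rewrite powRr0 mulr1 powRr1.
have zero (u : I -> R) (s : seq I) p : (forall i, 0 <= u i) -> 0 < p ->
    \sum_(i <- s) u i = 0 -> forall v : I -> R, \sum_(i <- s) u i `^ p * v i = 0.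
  move=> u0 p0; elim: s => [|i s IH]; first by move=> _ v; rewrite big_nil.
  rewrite big_cons => /eqP; rewrite paddr_eq0 ?sumr_ge0// => /andP[/eqP ui /eqP us] v.
  by rewrite big_cons ui powR0 ?gt_eqF// mul0r add0r IH.
have t1' : 0 < 1 - t by rewrite subr_gt0.
have [FE|F1] := eqVneq (\sum_(i <- r) f i) 0.
  by rewrite (zero f)// mulr_ge0 ?powR_ge0.
have [GE|G1] := eqVneq (\sum_(i <- r) g i) 0.
  under eq_bigr do rewrite mulrC.
  by rewrite (zero g)// mulr_ge0 ?powR_ge0.
set F := \sum_(i <- r) f i in F0 F1 *; set G := \sum_(i <- r) g i in G0 G1 *.
have Fp : 0 < F by rewrite lt_neqAle eq_sym F1.
have Gp : 0 < G by rewrite lt_neqAle eq_sym G1.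
have Ft : 0 < F `^ t by rewrite powR_gt0.
have Gt : 0 < G `^ (1 - t) by rewrite powR_gt0.
rewrite (eq_bigr (fun i => F `^ t * G `^ (1 - t) *
    ((f i / F) `^ t * (g i / G) `^ (1 - t)))); last first.
  move=> i _; rewrite mulrACA -!powRM ?divr_ge0//.
  by rewrite ![_ * (_ / _)]mulrC !divfK.
rewrite -mulr_sumr ler_piMr ?mulr_ge0 ?powR_ge0//.
apply: (@le_trans _ _ (\sum_(i <- r) (t / F * f i + (1 - t) / G * g i))).
  apply: ler_sum => i _.
  have -> : t / F * f i + (1 - t) / G * g i = t * (f i / F) + (1 - t) * (g i / G) by ring.
  by apply: young_powR; rewrite ?divr_ge0// t0.
rewrite big_split/= -!mulr_sumr -/F -/G !divfK//; lra.
Qed.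

(** Minkowski's inequality for a positive linear functional [E] in place of the
outer sum, by duality: pair [T i s] with the extremal weights
[E (T i) ^ (p - 1)]. It is used for finite sums and for expectations. *)
Lemma minkowski_functional (S : Type) n (E : (S -> R) -> R) (T : 'I_n -> S -> R) p :
  (forall f g, (forall s, f s <= g s) -> E f <= E g) ->
  (forall a f, E (fun s => a * f s) = a * E f) ->
  (forall f : 'I_n -> S -> R, E (fun s => \sum_(i < n) f i s) = \sum_(i < n) E (f i)) ->
  (forall i s, 0 <= T i s) -> 1 <= p ->
  (\sum_(i < n) E (T i) `^ p) `^ p^-1 <= E (fun s => (\sum_(i < n) T i s `^ p) `^ p^-1).
Proof.
move=> Emono EZ Esum T0 p1; have p0 : 0 < p by rewrite (lt_le_trans _ p1).
have E_ge0 f : (forall s, 0 <= f s) -> 0 <= E f.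
  move=> f0; rewrite -[leLHS](mul0r (E f)) -EZ.
  by apply: Emono => s; rewrite mul0r.
set X := \sum_(i < n) _.
have X0 : 0 <= X by apply: sumr_ge0 => i _; exact: powR_ge0.
have RHS0 : 0 <= E (fun s => (\sum_(i < n) T i s `^ p) `^ p^-1).
  by apply: E_ge0 => s; exact: powR_ge0.
have [->|Xn0] := eqVneq X 0; first by rewrite powR0// invr_eq0 gt_eqF.
have Xp : 0 < X by rewrite lt_neqAle eq_sym Xn0.
have pE : 1 - p^-1 + p^-1 = 1 by rewrite subrK.
have XE : X `^ (1 - p^-1) * X `^ p^-1 = X by rewrite -powRD ?pE ?powRr1// oner_eq0.
rewrite -(ler_pM2l (powR_gt0 (1 - p^-1) Xp)) XE -EZ.
rewrite [leLHS](_ : X = E (fun s => \sum_(i < n) E (T i) `^ (p - 1) * T i s)); last first.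
  rewrite Esum; apply: eq_bigr => i _; rewrite EZ mulrC mulr_powRB1//.
  exact: E_ge0.
apply: Emono => s.
have t01 : 0 <= 1 - p^-1 <= 1.
  by rewrite subr_ge0 invf_le1// p1 gerBl invr_ge0 ltW.
have := @holder_sum _ (index_enum 'I_n) (fun i => E (T i) `^ p) (fun i => T i s `^ p)
  (1 - p^-1) t01 (fun i => powR_ge0 _ _) (fun i => powR_ge0 _ _).
have -> : 1 - (1 - p^-1) = p^-1 by ring.
move=> h; apply: le_trans _ h; apply: ler_sum => i _.
rewrite -!powRrM mulfV ?gt_eqF// [T i s `^ 1]powRr1//.
by rewrite mulrBr mulr1 mulfV ?gt_eqF.
Qed.

End FiniteInequalities.

(** * Mixed norms and interpolation *)

Section MixedNorm.
Variables (R : realType) (n : nat).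
Implicit Types (a : seq nat -> R) (rs : seq R).

(** The list [rs] holds the reciprocals of the exponents, in which
interpolation is affine. *)
Fixpoint mnorm rs a : R :=
  if rs is r :: rs' then
    (\sum_(i < n) mnorm rs' (fun s => a (val i :: s)) `^ r^-1) `^ r
  else a [::].

Lemma mnorm_ge0 rs a : (forall s, 0 <= a s) -> 0 <= mnorm rs a.
Proof. by case: rs => [|r rs] a0 /=; [exact: a0|exact: powR_ge0]. Qed.

(** Hoelder's inequality, one coordinate at a time. *)
Lemma mnorm_interpolation (I : Type) (l : seq I) (f g : I -> R) t a :
  0 <= t <= 1 -> (forall i, 0 < f i) -> (forall i, 0 < g i) ->
  (forall s, 0 <= a s) ->
  mnorm [seq t * f i + (1 - t) * g i | i <- l] a <=
  mnorm [seq f i | i <- l] a `^ t * mnorm [seq g i | i <- l] a `^ (1 - t).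
Proof.
move=> t01 f0 g0; have [t0 t1] := andP t01.
elim: l a => [|j l IH] a a0 /=.
  have [->|aN0] := eqVneq (a [::]) 0; last first.
    by rewrite -powRD ?aN0 ?implybT// addrC subrK powRr1.
  by rewrite mulr_ge0 ?powR_ge0.
set r := t * f j + (1 - t) * g j.
have r0 : 0 < r.
  move: t0; rewrite /r le_eqVlt => /predU1P[<-|t0].
    by rewrite mul0r subr0 mul1r add0r.
  by rewrite ltr_pwDl ?mulr_gt0// mulr_ge0 ?subr_ge0// ltW.
have rN0 : r != 0 by rewrite gt_eqF.
pose A i := mnorm [seq f i | i <- l] (fun s => a (i :: s)).
pose B i := mnorm [seq g i | i <- l] (fun s => a (i :: s)).
have A0 i : 0 <= A i by exact: mnorm_ge0.
have B0 i : 0 <= B i by exact: mnorm_ge0.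
pose u := t * f j / r.
have u01 : 0 <= u <= 1.
  rewrite divr_ge0 ?mulr_ge0 ?(ltW (f0 _)) ?(ltW r0)//= ler_pdivrMr// mul1r.
  by rewrite lerDl mulr_ge0 ?subr_ge0// ltW.
have u1 : 1 - u = (1 - t) * g j / r by rewrite /u /r; field.
have := @holder_sum R _ (index_enum 'I_n) (fun i => A i `^ (f j)^-1)
   (fun i => B i `^ (g j)^-1) u u01 (fun i => powR_ge0 _ _) (fun i => powR_ge0 _ _).
set SA := \sum_(i < n) A i `^ (f j)^-1; set SB := \sum_(i < n) B i `^ (g j)^-1.
move=> hol.
apply: (@le_trans _ _ ((SA `^ u * SB `^ (1 - u)) `^ r)).
  apply: ge0_ler_powR; rewrite ?nnegrE ?(ltW r0)//.
  - by apply: sumr_ge0 => i _; exact: powR_ge0.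
  - by rewrite mulr_ge0 ?powR_ge0.
  apply: le_trans _ hol; apply: ler_sum => i _.
  apply: (@le_trans _ _ ((A i `^ t * B i `^ (1 - t)) `^ r^-1)).
    apply: ge0_ler_powR; rewrite ?nnegrE ?invr_ge0 ?(ltW r0)//.
    - exact: mnorm_ge0.
    - by rewrite mulr_ge0 ?powR_ge0.
    - by apply: IH => s; exact: a0.
  rewrite powRM ?powR_ge0// -!powRrM.
  have -> : (f j)^-1 * u = t / r by rewrite /u; field; rewrite rN0 gt_eqF.
  have -> // : (g j)^-1 * (1 - u) = (1 - t) / r.
  by rewrite u1; field; rewrite rN0 gt_eqF.
have e1 : u * r = f j * t by rewrite /u divfK// mulrC.
have e2 : (1 - u) * r = g j * (1 - t) by rewrite u1 divfK// mulrC.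
have s1 := powRrM SA u r; have s2 := powRrM SB (1 - u) r.
have s3 := powRrM SA (f j) t; have s4 := powRrM SB (g j) (1 - t).
rewrite (powRM r (powR_ge0 _ _) (powR_ge0 _ _)).
have l1 := etrans (esym s1) (etrans (congr1 (powR SA) e1) s3).
have l2 := etrans (esym s2) (etrans (congr1 (powR SB) e2) s4).
by rewrite [leLHS](congr2 *%R l1 l2).
Qed.

Lemma mnorm_interpolation_le (I : Type) (l : seq I) (f g : I -> R) t a D :
  0 <= t <= 1 -> (forall i, 0 < f i) -> (forall i, 0 < g i) ->
  (forall s, 0 <= a s) ->
  mnorm [seq f i | i <- l] a <= D -> mnorm [seq g i | i <- l] a <= D ->
  mnorm [seq t * f i + (1 - t) * g i | i <- l] a <= D.
Proof.
move=> t01 f0 g0 a0 fD gD; have [t0 t1] := andP t01.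
have fm := mnorm_ge0 [seq f i | i <- l] a0.
have D0 : 0 <= D := le_trans fm fD.
rewrite (le_trans (mnorm_interpolation l t01 f0 g0 a0))//.
have DE : D = D `^ t * D `^ (1 - t).
  have [->|DN0] := eqVneq D 0; last first.
    by rewrite -powRD ?DN0 ?implybT// addrC subrK powRr1.
  move: t0; rewrite le_eqVlt => /predU1P[<-|t0].
    by rewrite subr0 powRr1// mulr0.
  by rewrite powR0 ?mul0r// gt_eqF.
rewrite [leRHS]DE ler_pM ?powR_ge0// ge0_ler_powR ?nnegrE// ?subr_ge0//.
exact: mnorm_ge0.
Qed.

End MixedNorm.

(** * Extreme exponents *)

Section Vertices.
Variables (R : realType) (n m k : nat).
Hypothesis k0 : (0 < k)%N.
Local Notation u := (k%:R^-1 : R).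
Implicit Types (x : 'I_m -> R) (i j l : 'I_m).

Definition fractional x : {set 'I_m} := [set j | 0 < x j < u]%SET.

Definition hypersimplex x := (forall j, 0 <= x j <= u) /\ \sum_j x j = 1.

Definition shift2 x i j d l : R := x l + d * ((l == i)%:R - (l == j)%:R).

(** Moving mass from [j] to [i] as far as the constraints allow makes one of the
two coordinates extreme. *)
Lemma shift2_fractional x i j (d := Num.min (u - x i) (x j)) :
  hypersimplex x -> i \in fractional x -> j \in fractional x -> i != j ->
  [/\ 0 < d, hypersimplex (shift2 x i j d) &
      (#|fractional (shift2 x i j d)| < #|fractional x|)%N].
Proof.
move=> [xb x1] ix jx ij.
have [/andP[i0 iu] /andP[j0 ju]] : 0 < x i < u /\ 0 < x j < u.
  by move: ix jx; rewrite !inE.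
have d0 : 0 < d by rewrite lt_min subr_gt0 iu.
have di : d <= u - x i by rewrite ge_min lexx.
have dj : d <= x j by rewrite ge_min lexx orbT.
have yi : shift2 x i j d i = x i + d by rewrite /shift2 eqxx (negbTE ij) subr0 mulr1.
have yj : shift2 x i j d j = x j - d.
  by rewrite /shift2 eqxx eq_sym (negbTE ij) sub0r mulrN1.
have yl l : l != i -> l != j -> shift2 x i j d l = x l.
  by move=> /negbTE li /negbTE lj; rewrite /shift2 li lj subrr mulr0 addr0.
split => //.
  split=> [l|].
    have [->|li] := eqVneq l i; first by rewrite yi; apply/andP; split; lra.
    have [->|lj] := eqVneq l j; first by rewrite yj; apply/andP; split; lra.
    by rewrite yl.
  rewrite big_split/= -mulr_sumr sumrB x1.
  have one l : \sum_(l' < m) (l' == l)%:R = 1 :> R.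
    by rewrite (bigD1 l)//= eqxx big1 ?addr0// => l' /negbTE ->.
  by rewrite !one subrr mulr0 addr0.
apply: proper_card; apply/properP; split.
  apply/fintype.subsetP => l; rewrite [in X in X -> _]inE.
  have [->//|li] := eqVneq l i; have [->//|lj] := eqVneq l j.
  by rewrite yl// inE.
have [ge|lt] := leP (u - x i) (x j).
  exists i => //; rewrite inE yi /d (min_idPl ge).
  by rewrite addrC subrK ltxx andbF.
exists j => //; rewrite inE yj /d (min_idPr (ltW lt)).
by rewrite subrr ltxx.
Qed.

(** The other coordinates cannot all be multiples of [1 / k], because then so
would be the remaining one. *)
Lemma fractional_pair x i : hypersimplex x -> i \in fractional x ->
  exists2 j, j \in fractional x & i != j.
Proof.
move=> [xb x1] ix; apply/exists_inP; apply: contraPT isT => /exists_inPn H.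
have ku : 0 < k%:R :> R by rewrite ltr0n.
pose b l : nat := nat_of_bool (0 < x l).
have xl l : l != i -> x l = (b l)%:R * u.
  move=> li; have /andP[l0 lu] := xb l.
  have : ~~ (0 < x l < u).
    apply/negP => lx; have := H l; rewrite inE => /(_ lx).
    by rewrite negbK eq_sym (negbTE li).
  rewrite negb_and -!leNgt /b; have [xl0|xl0] := ltP 0 (x l).
    by rewrite mul1r => /orP[//|ul]; apply/eqP; rewrite eq_le lu.
  by move=> _; rewrite mul0r; apply/eqP; rewrite eq_le xl0.
pose B := (\sum_(l < m | l != i) b l)%N.
have : x i = 1 - B%:R * u.
  apply/eqP; rewrite eq_sym subr_eq eq_sym; apply/eqP; move: x1.
  by rewrite (bigD1 i)//= (eq_bigr _ xl) -mulr_suml -natr_sum.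
move=> xiE; move: ix; rewrite inE xiE.
have -> : 1 - B%:R * u = (k%:R - B%:R) / k%:R by field; rewrite gt_eqF.
rewrite pmulr_lgt0 ?invr_gt0// subr_gt0 ltr_nat ltr_pdivrMr// mulVf ?gt_eqF//.
rewrite ltrBlDr nat1r ltr_nat ltnS => /andP[Bk kB].
by rewrite leqNgt Bk in kB.
Qed.

(** A point with two fractional coordinates is a barycentre of two points with
fewer of them, obtained by moving mass between these coordinates in both
directions; interpolation bounds its norm by the larger of the two. *)
Lemma mnorm_vertices (a : seq nat -> R) D : (forall s, 0 <= a s) ->
  (forall A : {set 'I_m}, #|A| = k ->
     mnorm n [seq (1 + (j \in A)%:R * u) / 2 | j <- enum 'I_m] a <= D) ->
  forall x, hypersimplex x -> mnorm n [seq (1 + x j) / 2 | j <- enum 'I_m] a <= D.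
Proof.
move=> a0 vD x; have [p] := ubnP #|fractional x|; elim: p x => // p IH x xp xh.
have [xb x1] := xh.
have [fr0|[i ix]] := set_0Vmem (fractional x).
  have ku : 0 < k%:R :> R by rewrite ltr0n.
  pose A : {set 'I_m} := [set j | 0 < x j]%SET.
  have xA j : x j = (j \in A)%:R * u.
    have /andP[j0 ju] := xb j; rewrite /A inE.
    have : j \notin fractional x by rewrite fr0 inE.
    rewrite inE negb_and -!leNgt; have [xj0|xj0] := ltP 0 (x j).
      by rewrite mul1r => /orP[//|uj]; apply/eqP; rewrite eq_le ju.
    by move=> _; rewrite mul0r; apply/eqP; rewrite eq_le xj0.
  have -> : [seq (1 + x j) / 2 | j <- enum 'I_m] =
            [seq (1 + (j \in A)%:R * u) / 2 | j <- enum 'I_m].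
    by apply: eq_map => j; rewrite xA.
  apply: vD; apply/eqP; rewrite -(eqr_nat R).
  have := x1; rewrite (eq_bigr _ (fun j _ => xA j)) -mulr_suml -natr_sum.
  rewrite -sum1_card => h1; apply/eqP.
  move: h1 => /(congr1 ( *%R^~ k%:R)); rewrite /= divfK ?gt_eqF// mul1r => <-.
  by congr (_%:R); rewrite [LHS]big_mkcond; apply: eq_bigr => j _; case: (j \in A).
have [j jx ij] := fractional_pair xh ix.
have [d0 yh yp] := shift2_fractional xh ix jx ij.
have ji : j != i by rewrite eq_sym.
have [e0 zh zp] := shift2_fractional xh jx ix ji.
set d := Num.min _ _ in d0 yh yp; set e := Num.min _ _ in e0 zh zp.
have xE l : (1 + x l) / 2 = e / (d + e) * ((1 + shift2 x i j d l) / 2) +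
   (1 - e / (d + e)) * ((1 + shift2 x j i e l) / 2).
  by rewrite /shift2; field; rewrite gt_eqF// addr_gt0.
rewrite (eq_map xE).
have pos y : hypersimplex y -> forall l, 0 < (1 + y l) / 2.
  by move=> [yb _] l; have /andP[yl _] := yb l; rewrite divr_gt0//; lra.
apply: mnorm_interpolation_le => //.
- rewrite divr_ge0 ?addr_ge0 ?(ltW d0) ?(ltW e0)//= ler_pdivrMr ?addr_gt0//.
  by rewrite mul1r lerDr ltW.
- exact: pos.
- exact: pos.
- by apply: IH => //; rewrite -ltnS (leq_trans _ xp).
- by apply: IH => //; rewrite -ltnS (leq_trans _ xp).
Qed.

End Vertices.

(** * Arrays of coefficients of bounded forms *)

Section Arrays.
Variables (R : realType) (n : nat).
Local Notation C := (complex R).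
Local Notation arr := (seq nat -> C).
Implicit Types (c d : arr) (M : R).

Definition slice (i : nat) c : arr := fun s => c (i :: s).

(** The array of the form obtained by plugging [z] in the first variable. *)
Definition contract (z : nat -> C) c : arr := fun s => \sum_(i < n) z i * c (val i :: s).

Definition polydisc (z : nat -> C) := forall i, normc (z i) <= 1.

(** [c] is the array of an [m]-linear form in [n] coordinates whose modulus is
at most [M] on the polydisc. *)
Fixpoint bounded_form m M c : Prop :=
  if m is m'.+1 then forall z, polydisc z -> bounded_form m' M (contract z c)
  else normc (c [::]) <= M.

Lemma eq_bounded_form m M c d : c =1 d -> bounded_form m M c -> bounded_form m M d.
Proof. by move=> /funext ->. Qed.

(** The analogue of [contract] for the variable of index [j], with [0] as default
value at words that have no letter of index [j - 1]. *)
Fixpoint contract_at j (z : nat -> C) c : arr :=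
  if j is j'.+1 then fun s => if s is i :: s' then contract_at j' z (slice i c) s' else 0
  else contract z c.

Lemma contract_at_cat j z c s t : size s = j ->
  contract_at j z c (s ++ t) = \sum_(i < n) z i * c (s ++ val i :: t).
Proof.
elim: j c s => [|j IH] c [|i s]//= [sj].
by rewrite IH.
Qed.

Lemma contract_at_sum j z (y : nat -> C) (f : nat -> arr) s :
  contract_at j z (fun t => \sum_(i < n) y i * f i t) s =
  \sum_(i < n) y i * contract_at j z (f i) s.
Proof.
elim: j f s => [|j IH] f s /=.
  rewrite /contract; under eq_bigr do rewrite mulr_sumr.
  rewrite exchange_big/=; apply: eq_bigr => i _; rewrite mulr_sumr.
  by apply: eq_bigr => l _; rewrite mulrCA.
case: s => [|l s]; first by rewrite big1// => i _; rewrite mulr0.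
exact: (IH (fun i => slice l (f i))).
Qed.

Lemma contract_contract_at j z y c :
  contract y (contract_at j.+1 z c) = contract_at j z (contract y c).
Proof.
apply/funext => s; rewrite /contract /=.
by rewrite (contract_at_sum j z y (fun i => slice i c)).
Qed.

Lemma bounded_contract_at j l M z c : polydisc z ->
  bounded_form (j + l).+1 M c -> bounded_form (j + l) M (contract_at j z c).
Proof.
move=> z1; elim: j c => [|j IH] c; first by apply.
move=> H y y1; rewrite contract_contract_at; apply: IH.
exact: H.
Qed.

Fixpoint word_sum k (f : seq nat -> R) : R :=
  if k is k'.+1 then \sum_(i < n) word_sum k' (fun s => f (val i :: s)) else f [::].

Lemma eq_word_sum k f g : (forall s, size s = k -> f s = g s) -> word_sum k f = word_sum k g.
Proof.
elim: k f g => [|k IH] f g fg /=; first exact: fg.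
by apply: eq_bigr => i _; apply: IH => s sk; apply: fg; rewrite /= sk.
Qed.

Lemma word_sum_rcons k f :
  word_sum k.+1 f = word_sum k (fun s => \sum_(i < n) f (rcons s (val i))).
Proof.
elim: k f => [//|k IH] f.
by apply: eq_bigr => i _; exact: (IH (fun s => f (val i :: s))).
Qed.

Lemma mnorm_word_sum k (r : R) (a : seq nat -> R) : r != 0 -> (forall s, 0 <= a s) ->
  mnorm n (nseq k r) a `^ r^-1 = word_sum k (fun s => a s `^ r^-1).
Proof.
move=> r0; elim: k a => [//|k IH] a a0 /=.
rewrite -powRrM mulfV// powRr1; last by apply: sumr_ge0 => i _; exact: powR_ge0.
by apply: eq_bigr => i _; rewrite IH.
Qed.

Lemma signE_word_sum N k (f : seq nat -> seq C -> R) : (0 < N)%N ->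
  signE N n (fun z => word_sum k (f^~ z)) = word_sum k (fun s => signE N n (f s)).
Proof.
move=> N0; elim: k f => [//|k IH] f /=.
rewrite signE_sum//; apply: eq_bigr => i _.
exact: (IH (fun s => f (val i :: s))).
Qed.

Lemma root_avg_signE N (f : C -> seq C -> R) : (0 < N)%N ->
  root_avg N (fun z => signE N n (f z)) = signE N n (fun s => root_avg N (f^~ s)).
Proof.
move=> N0; rewrite /root_avg mulrC -signE_sum// -signEZ.
by apply: eq_signE => s; rewrite mulrC.
Qed.

Lemma signE_exchange N m (f : seq C -> seq C -> R) : (0 < N)%N ->
  signE N m (fun s => signE N n (f s)) = signE N n (fun t => signE N m (f^~ t)).
Proof.
move=> N0; elim: m f => [//|m IH] f /=; rewrite -root_avg_signE//.
by apply: eq_root_avg => z; rewrite IH.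
Qed.

(** * Trading square sums for random multipliers *)

Section KhinchineStage.
Variables (N : nat) (l kl : R).
Hypotheses (N0 : (0 < N)%N) (l0 : 0 < l) (l2 : l <= 2) (kl0 : 0 <= kl).
Hypothesis khin : forall b : nat -> C, sqsum n b `^ (l / 2) <=
  kl * signE N n (fun s => normc (signed_sum n b s) `^ l).
Implicit Types (sg : seq bool).

(** In a pattern, [true] marks a coordinate with exponent [l] and [false] one
with exponent [2], which is replaced by a random contraction. *)
Fixpoint pattern_sum sg c : R :=
  match sg with
  | [::] => normc (c [::]) `^ l
  | true :: sg' => \sum_(i < n) pattern_sum sg' (slice i c)
  | false :: sg' => signE N n (fun z => pattern_sum sg' (contract (nth 0 z) c))
  end.

Lemma pattern_sum_ge0 sg c : 0 <= pattern_sum sg c.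
Proof.
elim: sg c => [|[] sg IH] c /=; first exact: powR_ge0.
  by apply: sumr_ge0 => i _.
by rewrite -(signE_cst n 0 N0); apply: ler_signE => s _ _.
Qed.

Let rho := 2 / l.
Let rho1 : 1 <= rho. Proof. by rewrite ler_pdivlMr// mul1r. Qed.

Let minkE m (T : 'I_n -> seq C -> R) : (forall i s, 0 <= T i s) ->
  (\sum_(i < n) signE N m (T i) `^ rho) `^ rho^-1 <=
  signE N m (fun s => (\sum_(i < n) T i s `^ rho) `^ rho^-1).
Proof.
move=> T0; apply: minkowski_functional => //.
- by move=> f g fg; apply: ler_signE => s _ _.
- by move=> a f; exact: signEZ.
- by move=> f; exact: signE_sum.
Qed.

Let minkS m (T : 'I_n -> 'I_m -> R) : (forall i j, 0 <= T i j) ->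
  (\sum_(i < n) (\sum_(j < m) T i j) `^ rho) `^ rho^-1 <=
  \sum_(j < m) (\sum_(i < n) T i j `^ rho) `^ rho^-1.
Proof.
move=> T0.
apply: (@minkowski_functional R 'I_m n (fun f => \sum_(j < m) f j) T rho) => //.
- by move=> f g fg; apply: ler_sum => j _.
- by move=> a f; rewrite mulr_sumr.
- by move=> f; rewrite exchange_big.
Qed.

(** The Khinchine inequality is applied at the innermost level; Minkowski's
inequality, of exponent [rho = 2 / l], carries the square sum inside through
the sums and expectations of the pattern. *)
Lemma pattern_sum_khinchine sg (c : nat -> arr) :
  (\sum_(i < n) pattern_sum sg (c i) `^ rho) `^ rho^-1 <=
  kl * signE N n (fun z => pattern_sum sg (fun s => signed_sum n (fun i => c i s) z)).
Proof.
elim: sg c => [|[] sg IH] c /=.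
- apply: le_trans _ (khin (fun i => c i [::])); rewrite le_eqVlt; apply/orP; left; apply/eqP.
  rewrite /sqsum /rho invf_div; congr (_ `^ _); apply: eq_bigr => i _.
  rewrite -powRrM mulrC divfK ?gt_eqF// powR_mulrn//.
  exact: normc_ge0.
- apply: le_trans (minkS _) _ => [i j|]; first exact: pattern_sum_ge0.
  rewrite signE_sum// mulr_sumr; apply: ler_sum => j _.
  exact: (IH (fun i => slice j (c i))).
- apply: le_trans (minkE n _) _ => [i s|]; first exact: pattern_sum_ge0.
  apply: (@le_trans _ _ (signE N n (fun z' => kl * signE N n (fun z =>
      pattern_sum sg (fun s => signed_sum n (fun i => contract (nth 0 z') (c i) s) z))))).
    apply: ler_signE => z' _ _.
    exact: (IH (fun i => contract (nth 0 z') (c i))).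
  rewrite signEZ ler_wpM2l// signE_exchange//.
  rewrite le_eqVlt; apply/orP; left; apply/eqP.
  apply: eq_signE => z; apply: eq_signE => z'; congr pattern_sum; apply/funext => s.
  rewrite /signed_sum /contract; under eq_bigr do rewrite mulr_sumr.
  rewrite exchange_big/=; apply: eq_bigr => i _; rewrite mulr_sumr.
  by apply: eq_bigr => j _; rewrite mulrCA.
Qed.

Lemma mnorm_le_pattern_sum sg c :
  mnorm n [seq if b then l^-1 else 2^-1 | b <- sg] (fun s => normc (c s)) `^ l <=
  kl ^+ count negb sg * pattern_sum sg c.
Proof.
elim: sg c => [|[] sg IH] c /=; first by rewrite expr0 mul1r.
  rewrite add0n -powRrM mulVf ?gt_eqF// powRr1; last first.
    by apply: sumr_ge0 => i _; exact: powR_ge0.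
  rewrite mulr_sumr; apply: ler_sum => i _; rewrite invrK.
  exact: (IH (slice i c)).
rewrite -powRrM invrK mulrC.
have E (x : R) : 0 <= x -> x `^ 2 = (x `^ l) `^ rho.
  by move=> x0; rewrite -powRrM /rho mulrC divfK// gt_eqF.
have K0 : 0 <= kl ^+ count negb sg by exact: exprn_ge0.
apply: (@le_trans _ _ ((\sum_(i < n)
    (kl ^+ count negb sg * pattern_sum sg (slice i c)) `^ rho) `^ rho^-1)).
  rewrite /rho invf_div; apply: ge0_ler_powR.
  - by rewrite divr_ge0// ltW.
  - by rewrite nnegrE; apply: sumr_ge0 => i _; exact: powR_ge0.
  - by rewrite nnegrE; apply: sumr_ge0 => i _; exact: powR_ge0.
  apply: ler_sum => i _; rewrite E; last first.
    by apply: mnorm_ge0 => s; exact: normc_ge0.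
  have r0 : 0 <= rho by rewrite divr_ge0// ltW.
  apply: (ge0_ler_powR r0); last exact: (IH (slice i c)).
    by rewrite nnegrE powR_ge0.
  by rewrite nnegrE mulr_ge0 ?pattern_sum_ge0.
have -> : (\sum_(i < n) (kl ^+ count negb sg * pattern_sum sg (slice i c)) `^ rho) `^ rho^-1
   = kl ^+ count negb sg * (\sum_(i < n) pattern_sum sg (slice i c) `^ rho) `^ rho^-1.
  under eq_bigr do rewrite powRM ?pattern_sum_ge0//.
  rewrite -mulr_sumr powRM ?powR_ge0//; last first.
    by apply: sumr_ge0 => i _; exact: powR_ge0.
  by rewrite -powRrM mulfV ?gt_eqF ?divr_gt0// powRr1.
rewrite add1n exprSr -mulrA ler_wpM2l//.
exact: (pattern_sum_khinchine sg (fun i => slice i c)).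
Qed.

Variables (k : nat) (M B : R).
Hypothesis UB : forall d, bounded_form k M d ->
  word_sum k (fun s => normc (d s) `^ l) <= B `^ l.

(** All the expectations are taken out and bounded pointwise: for fixed
multipliers the contracted array is that of a [k]-linear form with the same
bound. The first [j] variables are those already summed. *)
Lemma pattern_sum_le sg j d : (j + count id sg)%N = k ->
  bounded_form (j + size sg) M d ->
  word_sum j (fun s => pattern_sum sg (fun t => d (s ++ t))) <= B `^ l.
Proof.
elim: sg j d => [|[] sg IH] j d /=.
- rewrite !addn0 => -> bd; apply: le_trans _ (UB bd).
  rewrite le_eqVlt; apply/orP; left; apply/eqP.
  by apply: eq_word_sum => s _; rewrite cats0.
- rewrite add1n addnS -addSn => jk; rewrite addnS -addSn => bd.
  apply: le_trans _ (IH j.+1 d jk bd).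
  rewrite word_sum_rcons le_eqVlt; apply/orP; left; apply/eqP.
  apply: eq_word_sum => s _; apply: eq_bigr => i _; congr pattern_sum.
  by apply/funext => t; rewrite /slice cat_rcons.
- rewrite add0n addnS => jk bd; rewrite -(signE_word_sum _ (fun s z =>
    pattern_sum sg (contract (nth 0 z) (fun t => d (s ++ t)))))//.
  rewrite -[leRHS](signE_cst n _ N0); apply: ler_signE => z _ z1.
  have zu : polydisc (nth 0 z).
    move=> i; have [iz|iz] := ltnP i (size z); last by rewrite nth_default// normc0.
    by rewrite z1// mem_nth.
  apply: le_trans _ (IH j _ jk (bounded_contract_at zu bd)).
  rewrite le_eqVlt; apply/orP; left; apply/eqP.
  apply: eq_word_sum => s sj; congr pattern_sum; apply/funext => t.
  by rewrite contract_at_cat.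
Qed.

Lemma mnorm_pattern_le sg c : count id sg = k -> bounded_form (size sg) M c ->
  mnorm n [seq if b then l^-1 else 2^-1 | b <- sg] (fun s => normc (c s)) `^ l <=
  kl ^+ count negb sg * B `^ l.
Proof.
move=> sk bc; rewrite (le_trans (mnorm_le_pattern_sum _ _))// ler_wpM2l ?exprn_ge0//.
exact: (@pattern_sum_le sg 0 c).
Qed.

End KhinchineStage.
End Arrays.

(** * Induction on the number of equal exponents *)

Section Induction.
Variables (R : realType) (n : nat) (kappa : R).
Hypothesis gk : 1 - euler_gamma R < kappa.
Local Notation C := (complex R).

(** The reciprocal of [2 k / (k + 1)]. *)
Definition bh_recip (k : nat) : R := (1 + k%:R^-1) / 2.

Definition bh_uniform (k : nat) : R :=
  expR (kappa / 2 * \sum_(1 <= j < k) j%:R^-1).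

Definition bh_bound (k m : nat) : R :=
  expR (kappa / 2 * ((m - k)%:R / k%:R + \sum_(1 <= j < k) j%:R^-1)).

Let kappa0 : 0 <= kappa.
Proof. by rewrite (le_trans _ (ltW gk))// subr_ge0 euler_gamma_le1. Qed.

Lemma bh_recip_bounds k : (0 < k)%N -> 2^-1 < bh_recip k <= 1.
Proof.
move=> k0; have u0 : 0 < k%:R^-1 :> R by rewrite invr_gt0 ltr0n.
have u1 : k%:R^-1 <= 1 :> R by rewrite invf_le1 ?ltr0n// ler1n.
by rewrite /bh_recip; apply/andP; split; lra.
Qed.

Definition uniform_bh k := forall M (d : seq nat -> C), 0 <= M ->
  bounded_form n k M d ->
  word_sum n k (fun s => normc (d s) `^ (bh_recip k)^-1) <=
    (bh_uniform k * M) `^ (bh_recip k)^-1.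

Lemma mnorm_le_bh_bound k m M (c : seq nat -> C) (x : 'I_m -> R) :
  (0 < k)%N -> uniform_bh k -> 0 <= M -> bounded_form n m M c ->
  hypersimplex k x ->
  mnorm n [seq (1 + x j) / 2 | j <- enum 'I_m] (fun s => normc (c s)) <=
  bh_bound k m * M.
Proof.
move=> k0 Uk M0 cM; apply: mnorm_vertices => // [s|A cA]; first exact: normc_ge0.
have [N N1 khin] := khinchine n gk; have N0 := ltnW N1.
have /andP[r2 r1] := bh_recip_bounds k0.
have r0 : 0 < bh_recip k by rewrite (lt_trans _ r2)// invr_gt0.
pose l := (bh_recip k)^-1; have l0 : 0 < l by rewrite invr_gt0.
have l2 : l <= 2 by rewrite /l -[leRHS]invrK lef_pV2 ?posrE ?invr_gt0// ltW.
pose sg := [seq j \in A | j <- enum 'I_m].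
have -> : [seq (1 + (j \in A)%:R / k%:R) / 2 | j <- enum 'I_m] =
          [seq if b then l^-1 else 2^-1 | b <- sg].
  rewrite /sg -[RHS]map_comp; apply: eq_map => j /=; rewrite /l invrK /bh_recip.
  by case: (j \in A); rewrite ?mul1r// mul0r addr0 mul1r.
have cnt : count id sg = k.
  by rewrite count_map -cA cardE -size_filter enumT /enum_mem.
have ssg : size sg = m by rewrite size_map size_enum_ord.
have cneg : count negb sg = (m - k)%N.
  by rewrite -ssg -(count_predC id) cnt addKn; apply: eq_count.
have kc0 : 0 <= khin_const kappa l `^ l by exact: powR_ge0.
have key : mnorm n [seq if b then l^-1 else 2^-1 | b <- sg] (fun s => normc (c s)) `^ l
    <= (khin_const kappa l `^ l) ^+ count negb sg * (bh_uniform k * M) `^ l.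
  apply: (@mnorm_pattern_le R n N l _ N0 l0 l2 kc0 _ k M) => //.
  - by move=> b; apply: khin; rewrite l0.
  - by move=> d; apply: Uk.
  - by rewrite ssg.
have B0 : 0 <= bh_uniform k * M by rewrite mulr_ge0 ?expR_ge0.
have E0 : 0 <= khin_const kappa l ^+ (m - k) * (bh_uniform k * M).
  by rewrite mulr_ge0 ?exprn_ge0 ?expR_ge0.
have -> : bh_bound k m * M = khin_const kappa l ^+ (m - k) * (bh_uniform k * M).
  rewrite mulrA; congr (_ * _); rewrite /khin_const /bh_uniform /bh_bound.
  rewrite -expRM_natl -expRD; congr expR; rewrite mulrDr; congr (_ + _).
  by rewrite /l invrK /bh_recip; ring.
have := ge0_ler_powR (ltW r0) _ _ key.
rewrite !nnegrE powR_ge0 mulr_ge0 ?exprn_ge0 ?powR_ge0// => /(_ isT isT).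
rewrite -powRrM mulVf ?gt_eqF// powRr1; last by apply: mnorm_ge0 => s; exact: normc_ge0.
move=> /le_trans; apply.
have X : (khin_const kappa l `^ l) ^+ (m - k) = (khin_const kappa l ^+ (m - k)) `^ l.
  rewrite -powR_mulrn ?powR_ge0// -powRrM mulrC powRrM powR_mulrn//.
  exact: expR_ge0.
rewrite cneg X -powRM ?exprn_ge0 ?expR_ge0//.
by rewrite -powRrM mulVf ?gt_eqF// powRr1.
Qed.

(** Align the phases of the coefficients. *)
Lemma uniform_bh1 : uniform_bh 1.
Proof.
move=> M d M0 /= dM.
have -> : bh_recip 1 = 1 by rewrite /bh_recip invr1; field.
rewrite invr1 /bh_uniform big_geq// mulr0 expR0 mul1r powRr1//.
pose z i : C := let w := d [:: i] in if w == 0 then 0 else (normc w)%:C%C / w.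
have nR (t : R) : 0 <= t -> normc t%:C%C = t.
  by move=> t0; rewrite /= expr0n addr0 sqrtr_sqr ger0_norm.
have z1 : polydisc z.
  move=> i; rewrite /z; have [_|w0] := eqVneq; first by rewrite normc0.
  rewrite normcM normcV nR ?normc_ge0// divff//.
  by apply: contra w0 => /eqP/eq0_normc ->.
apply: le_trans _ (dM z z1).
have -> : contract n z d [::] = (\sum_(i < n) normc (d [:: val i]))%:C%C.
  rewrite /contract rmorph_sum; apply: eq_bigr => i _; rewrite /z.
  have [->|w0] := eqVneq; first by rewrite normc0 mulr0.
  by rewrite divfK.
rewrite nR; last by apply: sumr_ge0 => i _; exact: normc_ge0.
by apply: ler_sum => i _; rewrite powRr1 ?normc_ge0.
Qed.

(** The exponents of the uniform case at [k + 1] correspond to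
[x_i = 1 / (k + 1) <= 1 / k]. *)
Lemma uniform_bhS k : (0 < k)%N -> uniform_bh k -> uniform_bh k.+1.
Proof.
move=> k0 Uk M d M0 dM.
have kR : 0 < k%:R :> R by rewrite ltr0n.
pose x (_ : 'I_k.+1) : R := k.+1%:R^-1.
have hx : hypersimplex k x.
  split=> [j|]; first by rewrite /x invr_ge0 ler0n lef_pV2 ?posrE ?ltr0n// ler_nat leqnSn.
  by rewrite /x sumr_const card_ord -[_ *+ _]mulr_natr mulVf ?pnatr_eq0.
have := mnorm_le_bh_bound k0 Uk M0 dM hx.
have -> : [seq (1 + x j) / 2 | j <- enum 'I_k.+1] = nseq k.+1 (bh_recip k.+1).
  have H (s : seq 'I_k.+1) :
      [seq (1 + x j) / 2 | j <- s] = nseq (size s) (bh_recip k.+1).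
    by elim: s => //= j s ->.
  by rewrite H size_enum_ord.
have -> : bh_bound k k.+1 = bh_uniform k.+1.
  rewrite /bh_bound /bh_uniform subSnn big_nat_recr//=.
  by rewrite addrC mul1r.
have /andP[r2 r1] := @bh_recip_bounds k.+1 isT.
have r0 : 0 < bh_recip k.+1 by rewrite (lt_trans _ r2)// invr_gt0.
move=> h; rewrite -mnorm_word_sum ?gt_eqF//; last by move=> s; exact: normc_ge0.
apply: ge0_ler_powR; rewrite ?nnegrE ?invr_ge0 ?(ltW r0)//.
  by apply: mnorm_ge0 => s; exact: normc_ge0.
by rewrite mulr_ge0 ?expR_ge0.
Qed.

Lemma uniform_bhP k : (0 < k)%N -> uniform_bh k.
Proof.
case: k => // k _; elim: k => [|k IH]; first exact: uniform_bh1.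
exact: uniform_bhS.
Qed.

End Induction.

(** * From forms on [c_0] to arrays, and from finite sums to series *)

Section FormToArray.
Variables (R : realType) (m : nat) (L : ('I_m -> c0 R) -> R[i]%C) (M : R) (n : nat).
Hypothesis multL : multilinear L.
Hypothesis boundL : forall x : 'I_m -> c0 R, (forall k, `|x k| <= 1) -> normc (L x) <= M.

Definition c0_comb (z : nat -> complex R) : c0 R := \sum_(i < n) z i *: c0_basis R i.

Lemma c0_combE z j : c0_comb z j = if (j < n)%N then z j else 0.
Proof.
rewrite /c0_comb.
have -> : forall (r : seq 'I_n), c0_seq (\sum_(i <- r) z i *: c0_basis R i) j =
   \sum_(i <- r) z i * (j == i :> nat)%:R.
  elim=> [|i r IH]; first by rewrite !big_nil.
  by rewrite !big_cons -IH.
case: ifP => jn.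
  rewrite (bigD1 (Ordinal jn))//= eqxx mulr1 big1 ?addr0// => i ij.
  have /negbTE -> : j != i :> nat; last by rewrite mulr0.
  by apply: contra ij => /eqP ji; apply/eqP/val_inj.
rewrite big1// => i _; case: eqP => [ji|]; last by rewrite mulr0.
by rewrite ji ltn_ord in jn.
Qed.

Lemma c0_comb_le1 z : polydisc z -> `|c0_comb z| <= 1.
Proof.
move=> z1; rewrite -[leLHS]/((sup_norm (c0_comb z))%:C%C) -[1]/(1%:C%C) lecR.
apply: sup_norm_le => j; rewrite c0_combE; case: ifP => _; first exact: z1.
by rewrite normc0.
Qed.

Lemma multilinear_comb (i : 'I_m) (x : 'I_m -> c0 R) z :
  L [eta x with i |-> c0_comb z] = \sum_(j < n) z j * L [eta x with i |-> c0_basis R j].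
Proof.
pose f (y : c0 R) : complex R := L [eta x with i |-> y].
have fl a u v : f (a *: u + v) = a * f u + f v := multL i x a u v.
have f0 : f 0 = 0.
  have := fl 1 0 0; rewrite scaler0 addr0 mul1r => /eqP.
  by rewrite -subr_eq subrr eq_sym => /eqP.
rewrite /c0_comb -/(f _).
have -> : forall (r : seq 'I_n),
    f (\sum_(j <- r) z j *: c0_basis R j) = \sum_(j <- r) z j * f (c0_basis R j).
  elim=> [|j r IH]; first by rewrite !big_nil.
  by rewrite !big_cons fl IH.
by [].
Qed.

Lemma c0_basis_le1 i : `|c0_basis R i| <= 1.
Proof.
rewrite -[leLHS]/((sup_norm (c0_basis R i))%:C%C) -[1]/(1%:C%C) lecR.
apply: sup_norm_le => j /=; case: (j == i); first by rewrite normc1.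
by rewrite normc0.
Qed.

Lemma form_array_bounded_prefix l j (xs : nat -> c0 R) : (j + l)%N = m ->
  (forall i, `|xs i| <= 1) ->
  bounded_form n l M (fun s => L (fun k : 'I_m =>
    if (k < j)%N then xs k else c0_basis R (nth 0%N s (k - j)))).
Proof.
elim: l j xs => [|l IH] j xs jm xs1 /=.
  apply: boundL => k; case: ifP => _; [exact: xs1|exact: c0_basis_le1].
move=> z z1; have jlt : (j < m)%N by rewrite -jm addnS ltnS leq_addr.
pose i := Ordinal jlt.
pose ys k := if k == j then c0_comb z else xs k.
have := IH j.+1 ys; rewrite addSnnS => /(_ jm) H.
apply: (eq_bounded_form _ (H _)); last first.
  by move=> k; rewrite /ys; case: ifP => _ //; exact: c0_comb_le1.
move=> s; rewrite /contract.
pose x (k : 'I_m) := if (k < j)%N then xs k else c0_basis R (nth 0%N s (k - j.+1)).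
transitivity (L [eta x with i |-> c0_comb z]).
  congr L; apply/funext => k /=; rewrite /ys /x -(inj_eq val_inj)/= ltnS.
  by case: ltngtP.
rewrite multilinear_comb; apply: eq_bigr => b _; congr (_ * L _).
apply/funext => k /=; rewrite /x -(inj_eq val_inj)/=.
have [kj|jk|->] := ltngtP k j; rewrite ?subnn//.
by rewrite -(subnSK jk).
Qed.

Lemma form_array_bounded :
  bounded_form n m M (fun s => L (fun k : 'I_m => c0_basis R (nth 0%N s k))).
Proof.
have := @form_array_bounded_prefix m 0 (fun=> 0) (add0n m).
have z1 : forall i : nat, `|0 : c0 R| <= 1 by move=> _; rewrite normr0 ler01.
move=> /(_ z1); apply: eq_bounded_form => s; congr L; apply/funext => k /=.
by rewrite subn0.
Qed.

End FormToArray.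

Section Truncation.
Variable R : realType.
Implicit Types (q : seq R) (a : seq nat -> \bar R) (n : nat).
Local Open Scope ereal_scope.

Fixpoint trunc_sum n q a : \bar R :=
  if q is p :: q' then
    \sum_(0 <= i < n) (trunc_sum n q' (fun s => a (i :: s))) `^ (p / head 1 q')%R
  else a [::].

Lemma trunc_sum_ge0 n q a : (forall s, 0 <= a s) -> 0 <= trunc_sum n q a.
Proof.
by case: q => [|p q] a0 /=; [exact: a0|apply: sume_ge0 => i _; exact: poweR_ge0].
Qed.

Lemma nested_sum_ge0 q a : (forall s, 0 <= a s) -> 0 <= nested_sum q a.
Proof.
case: q => [|p q] a0 /=; first exact: a0.
by apply: nneseries_ge0 => i _ _; exact: poweR_ge0.
Qed.

Lemma trunc_sum_homo q a : (forall s, 0 <= a s) -> all (fun p => 0 < p)%R q ->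
  {homo (fun n => trunc_sum n q a) : n1 n2 / (n1 <= n2)%N >-> n1 <= n2}.
Proof.
move=> + + n1 n2 n12; elim: q a => [//|p q IH] a a0 /= /andP[p0 q0].
have h0 : (0 <= p / head 1 q)%R.
  by rewrite divr_ge0 ?(ltW p0)//; case: q q0 {IH} => //= ? ? /andP[/ltW].
apply: (@le_trans _ _ (\sum_(0 <= i < n1)
    (trunc_sum n2 q (fun s => a (i :: s))) `^ (p / head 1 q)%R)).
  apply: lee_sum => i _; apply: gt0_ler_poweR => //.
  - by rewrite in_itv/= leey andbT; exact: trunc_sum_ge0.
  - by rewrite in_itv/= leey andbT; exact: trunc_sum_ge0.
  - by apply: IH => // s; exact: a0.
by apply: lee_sum_nneg_natr => // i _ _; exact: poweR_ge0.
Qed.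

(** The nested series is the supremum of its truncations; the induction uses
monotone convergence at each level. *)
Lemma nested_sum_le q a y : (forall s, 0 <= a s) -> all (fun p => 0 < p)%R q ->
  (forall n, trunc_sum n q a <= y) -> nested_sum q a <= y.
Proof.
elim: q a y => [|p q IH] a y a0; first by move=> _ /(_ 0%N).
move=> /= /andP[p0 q0] ty.
set r := (p / head 1 q)%R in ty *.
have r0 : (0 < r)%R.
  by rewrite divr_gt0//; case: q q0 {IH ty r} => //= ? ? /andP[].
have y0 : 0 <= y.
  by apply: le_trans (ty 0%N); apply: sume_ge0 => i _; exact: poweR_ge0.
pose u i n := (trunc_sum n q (fun s => a (i :: s))) `^ r.
have u_homo i : {homo u i : n1 n2 / (n1 <= n2)%N >-> n1 <= n2}.
  move=> n1 n2 n12; apply: gt0_ler_poweR; first exact: ltW.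
  - by rewrite in_itv/= leey andbT; apply: trunc_sum_ge0.
  - by rewrite in_itv/= leey andbT; apply: trunc_sum_ge0.
  - exact: trunc_sum_homo.
have u_cvg i : u i n @[n --> \oo] --> ereal_sup (range (u i)).
  exact: ereal_nondecreasing_cvgn.
have le_sup i : (nested_sum q (fun s => a (i :: s))) `^ r <= ereal_sup (range (u i)).
  have powK (w : \bar R) : 0 <= w -> (w `^ r) `^ r^-1 = w.
    by move=> w0; rewrite -poweRrM divff ?gt_eqF// poweRe1.
  set S := ereal_sup _.
  have S0 : 0 <= S.
    by apply: le_trans (ereal_sup_ubound _); [|exists 0%N => //]; exact: poweR_ge0.
  have -> : S = (S `^ r^-1) `^ r by rewrite -poweRrM mulVf ?gt_eqF// poweRe1.
  apply: gt0_ler_poweR; first exact: ltW.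
  - by rewrite in_itv/= leey andbT nested_sum_ge0.
  - by rewrite in_itv/= leey andbT poweR_ge0.
  apply: IH => // n.
  rewrite -[leLHS]powK; last exact: trunc_sum_ge0.
  apply: gt0_ler_poweR; first by rewrite invr_ge0 ltW.
  - by rewrite in_itv/= leey andbT poweR_ge0.
  - by rewrite in_itv/= leey andbT.
  - by apply: ereal_sup_ubound; exists n.
apply: lime_le.
  by apply: is_cvg_nneseries => i _ _; exact: poweR_ge0.
apply: nearW => N.
apply: (@le_trans _ _ (\sum_(0 <= i < N) ereal_sup (range (u i)))).
  by apply: lee_sum => i _.
have cvgN : \sum_(0 <= i < N) u i n @[n --> \oo] --> \sum_(0 <= i < N) ereal_sup (range (u i)).
  apply: cvg_nnesum => i _; last exact: u_cvg.
  by apply: nearW => n; exact: poweR_ge0.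
rewrite -(cvg_lim _ cvgN)//; apply: lime_le; first by apply/cvg_ex; eexists; exact: cvgN.
exists N => // n /= Nn; apply: le_trans (ty n).
by apply: lee_sum_nneg_natr => // i _ _; exact: poweR_ge0.
Qed.

Lemma trunc_sum_mnorm n q (f : seq nat -> R) : (forall s, 0 <= f s)%R ->
  all (fun p => 0 < p)%R q ->
  trunc_sum n q (fun s => (f s)%:E) = ((mnorm n (map GRing.inv q) f) `^ head 1 q)%:E.
Proof.
move=> + ; elim: q f => [|p q IH] f f0 /=; first by rewrite powRr1.
move=> /andP[p0 q0].
have h0 : (head 1 q != 0)%R.
  by case: q q0 {IH} => [|? ?] /=; [rewrite oner_eq0|case/andP => /gt_eqF ->].
rewrite -powRrM mulVf ?gt_eqF// powRr1; last first.
  by apply: sumr_ge0 => i _; exact: powR_ge0.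
rewrite big_mkord -sumEFin; apply: eq_bigr => i _.
rewrite IH// poweR_EFin -powRrM invrK; congr (_ `^ _)%:E.
by rewrite mulrC divfK.
Qed.

End Truncation.

(** * The bound for exponents close to [2 m / (m + 1)] *)

Section Main.
Variable R : realType.
Local Notation gamma := (euler_gamma R).

Lemma BH_constant_le (m : nat) (q : m.-tuple R) (B : R) : 1 <= B ->
  (0 < m)%N -> (forall i, 0 < tnth q i) ->
  (forall n M (c : seq nat -> complex R), 0 <= M -> bounded_form n m M c ->
     mnorm n (map GRing.inv q) (fun s => normc (c s)) <= B * M) ->
  (BH_constant q <= B%:E)%E.
Proof.
move=> B1 m0 q0 HB; apply: ereal_inf_lbound; exists B => //=; split=> // L mL _.
have B0 : 0 < B by rewrite (lt_le_trans _ B1).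
have qall : all (fun p => 0 < p)%R q by apply/all_tnthP.
have h0 : 0 < head 1 q by case: (tval q) qall => //= ? ? /andP[].
set F := form_norm L.
have Lx x : (forall k, `|x k| <= 1) -> ((normc (L x))%:E <= F)%E.
  by move=> x1; apply: ereal_sup_ubound; exists x.
have F0 : (0 <= F)%E.
  apply: le_trans (Lx (fun=> 0) _); first by rewrite lee_fin normc_ge0.
  by move=> k; rewrite normr0 ler01.
have [FE|] := eqVneq F +oo%E; first by rewrite FE gt0_muley ?lte_fin// leey.
move=> FN; have Ffin : F \is a fin_num by rewrite ge0_fin_numE// lt_neqAle FN leey.
pose M := fine F; have ME : F = M%:E by rewrite fineK.
have M0 : 0 <= M by rewrite -lee_fin -ME.
have LM x : (forall k, `|x k| <= 1) -> normc (L x) <= M.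
  by move=> /Lx; rewrite ME lee_fin.
rewrite ME -EFinM /mixed_norm.
have BM0 : 0 <= B * M by rewrite mulr_ge0// ltW.
have key : (nested_sum q (coeff_modulus L) <= ((B * M) `^ head 1 q)%:E)%E.
  apply: nested_sum_le => // [s|n]; first by rewrite lee_fin normc_ge0.
  rewrite (@trunc_sum_mnorm R n q (fun s => normc (L (fun k : 'I_m => c0_basis R (nth 0%N s k)))))//.
    rewrite lee_fin; apply: ge0_ler_powR; rewrite ?nnegrE ?(ltW h0)//.
      by apply: mnorm_ge0 => s; exact: normc_ge0.
    by apply: HB => //; exact: form_array_bounded.
  by move=> s; exact: normc_ge0.
have -> : (B * M)%:E = (((B * M) `^ head 1 q)%:E `^ (head 1%R q)^-1)%E.
  by rewrite poweR_EFin -powRrM divff ?gt_eqF// powRr1.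
apply: gt0_ler_poweR => //; first by rewrite invr_ge0 ltW.
- rewrite in_itv/= leey andbT; apply: nested_sum_ge0 => s.
  by rewrite lee_fin normc_ge0.
- by rewrite in_itv/= leey andbT lee_fin powR_ge0.
Qed.

Lemma BH_exponent_hypersimplex (m k : nat) (q : m.-tuple R) : (0 < k)%N ->
  BH_exponent q -> (forall i, 1 <= tnth q i <= 2) ->
  (forall i, 2 / tnth q i - 1 <= k%:R^-1) ->
  hypersimplex k (fun i => 2 / tnth q i - 1).
Proof.
move=> k0 bh q12 qk; split=> [i|].
  have /andP[q1 q2] := q12 i; rewrite qk andbT subr_ge0 ler_pdivlMr ?mul1r//.
  by rewrite (lt_le_trans _ q1).
by rewrite sumrB -mulr_sumr bh sumr_const card_ord -[m.+1%:R]natr1; field.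
Qed.

Lemma recip_exponents (m : nat) (q : m.-tuple R) :
  map GRing.inv q = [seq (1 + (2 / tnth q i - 1)) / 2 | i <- enum 'I_m].
Proof.
rewrite -[in LHS](map_tnth_enum q) -map_comp; apply: eq_map => i /=.
by rewrite addrC subrK mulrC mulrA mulVf ?mul1r// pnatr_eq0.
Qed.

(** [T] is an integer above [K + 2], and [k] is the integer part of [m / T], or
[1] when that vanishes: the hypothesis on the exponents gives
[2 / q_i - 1 <= 2 - q_i <= (K + 2) / m]. *)
Lemma exists_level (K : R) : 0 < K -> exists2 T : nat, (0 < T)%N &
  forall (m : nat) (q : m.-tuple R), (0 < m)%N -> 
  (forall i, 1 <= tnth q i <= 2) ->
  (forall i, `|tnth q i - (2 * m%:R) / (m%:R + 1)| <= K / m%:R) ->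
  exists k, [/\ (0 < k)%N, (k <= m)%N, (m <= 2 * T * k)%N &
     forall i, 2 / tnth q i - 1 <= k%:R^-1].
Proof.
move=> K0; pose T := (Num.truncn (K + 2)).+1.
have KT : K + 2 <= T%:R by rewrite ltW// truncnS_gt.
exists T => // m q m0 q12 qK.
have mR : 0 < m%:R :> R by rewrite ltr0n.
have [mT|Tm] := ltnP m T.
  exists 1%N; split=> //.
    by rewrite muln1 mul2n -addnn (leq_trans (ltnW mT))// leq_addr.
  move=> i; have /andP[q1 q2] := q12 i; rewrite invr1 lerBlDr.
  rewrite ler_pdivrMr ?(lt_le_trans _ q1)//; lra.
have T0 : (0 < T)%N by [].
have k0 : (0 < m %/ T)%N by rewrite divn_gt0.
exists (m %/ T)%N; split=> //; first exact: leq_div.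
  rewrite {1}(divn_eq m T) mulnC -mulnA mul2n -addnn leq_add2l.
  by rewrite (leq_trans (ltnW (ltn_pmod m T0)))// leq_pmulr.
move=> i; have /andP[q1 q2] := q12 i; have q0 : 0 < tnth q i by rewrite (lt_le_trans _ q1).
apply: (@le_trans _ _ (2 - tnth q i)).
  rewrite lerBlDr ler_pdivrMr//; nra.
apply: (@le_trans _ _ (T%:R / m%:R)).
  have := qK i; rewrite ler_norml => /andP[h _].
  have e : 2 - 2 * m%:R / (m%:R + 1) <= 2 / m%:R :> R.
    have -> : 2 - 2 * m%:R / (m%:R + 1) = 2 / (m%:R + 1) :> R.
      by field; rewrite gt_eqF// addr_gt0.
    by rewrite ler_wpM2l// lef_pV2 ?posrE ?addr_gt0// lerDl.
  apply: (@le_trans _ _ ((K + 2) / m%:R)).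
    by rewrite mulrDl; lra.
  by rewrite ler_wpM2r// invr_ge0 ltW.
rewrite -[leRHS]invrK invrK -[leLHS]invf_div lef_pV2 ?posrE ?divr_gt0 ?ltr0n//.
by rewrite ler_pdivlMr ?ltr0n// -natrM ler_nat leq_trunc_div.
Qed.

(** The slack of [kappa] over [1 - gamma] is chosen so that it contributes at
most [1 / 2] to the exponent. *)
Lemma bh_bound_le (T m k : nat) : (0 < T)%N -> (0 < k)%N -> (k <= m)%N ->
  (m <= 2 * T * k)%N -> exists2 kappa, 1 - gamma < kappa &
  bh_bound kappa k m <=
  expR ((1 - gamma) / 2 * (1 + (2 * T)%:R) + 2^-1) * m%:R `^ ((1 - gamma) / 2).
Proof.
move=> T0 k0 km mT; have g1 := euler_gamma_le1 R.
have m0 : (0 < m)%N := leq_trans k0 km.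
have kR : 0 < k%:R :> R by rewrite ltr0n.
pose D : R := (m - k)%:R / k%:R + \sum_(1 <= j < k) j%:R^-1.
have D0 : 0 <= D.
  by rewrite addr_ge0 ?divr_ge0// sumr_ge0// => j _; rewrite invr_ge0.
have DT : D <= (2 * T)%:R + (1 + ln m%:R).
  apply: lerD.
    rewrite ler_pdivrMr// -natrM ler_nat (leq_trans (leq_subr _ _))//.
  apply: (@le_trans _ _ (1 + ln k%:R)).
    case: k k0 {km mT kR D D0} => // k _.
    apply: le_trans (harmonic_le_ln R k); rewrite [leRHS]big_nat_recr//=.
    by rewrite lerDl invr_ge0.
  by rewrite lerD2l ler_ln ?posrE ?ltr0n// ler_nat.
exists (1 - gamma + (D + 1)^-1); first by rewrite ltrDl invr_gt0; lra.
have mR : m%:R != 0 :> R by rewrite pnatr_eq0 -lt0n.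
rewrite /bh_bound -/D /powR (negbTE mR) -expRD ler_expR.
have h1 : (D + 1)^-1 * D <= 1 by rewrite mulrC ler_pdivrMr ?mul1r; lra.
have h2 : (1 - gamma) * D <= (1 - gamma) * ((2 * T)%:R + (1 + ln m%:R)).
  by rewrite ler_wpM2l// subr_ge0.
lra.
Qed.

End Main.

Theorem proposition4p1 (R : realType) (K : R) (K_gt0 : 0 < K) :
  exists2 kappa : R, 0 < kappa &
    forall (m : nat) (q : m.-tuple R),
      (1 <= m)%N ->
      BH_exponent q ->
      (forall i : 'I_m, 1 <= tnth q i <= 2) ->
      (forall i : 'I_m,
         `|tnth q i - (2 * m%:R) / (m%:R + 1)| <= K / m%:R) ->
      (BH_constant q
         <= (kappa * m%:R `^ ((1 - euler_gamma R) / 2))%:E)%E.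
Proof.
have [T T0 level] := exists_level K_gt0.
have g1 := euler_gamma_le1 R.
exists (expR ((1 - euler_gamma R) / 2 * (1 + (2 * T)%:R) + 2^-1)).
  exact: expR_gt0.
move=> m q m0 bh q12 qK.
have [k [k0 km mk qk]] := level m q m0 q12 qK.
have [kappa gk kappaB] := bh_bound_le R T0 k0 km mk.
have hs := BH_exponent_hypersimplex k0 bh q12 qk.
apply: BH_constant_le => // [|i|n M c M0 cM].
- have mR : m%:R != 0 :> R by rewrite pnatr_eq0 -lt0n.
  rewrite /powR (negbTE mR) -expRD -[leLHS]expR0 ler_expR.
  have l0 : 0 <= ln m%:R :> R by rewrite ln_ge0// ler1n.
  by rewrite addr_ge0 ?addr_ge0 ?mulr_ge0 ?invr_ge0 ?subr_ge0.
- by have /andP[q1 _] := q12 i; rewrite (lt_le_trans _ q1).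
rewrite recip_exponents.
apply: le_trans (mnorm_le_bh_bound gk k0 (@uniform_bhP R n kappa gk k k0) M0 cM hs) _.
by rewrite ler_wpM2r.
Qed.
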